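(* Let $S\subset\mathbb{R}^d$ be nonempty and closed. Suppose that $X^1,X^2,\dots$ are iid random vectors with values in $S^0\subset\mathbb{R}^{d_0}$, $F$ is a closed subset of $(\mathrm{usc\text{-}fcns}(S),\mathbf{d})$, $F^n\subset F$ for $n\in\mathbb{N}$ with set-limit $\operatorname{Lim}F^n$, $\psi:S^0\times F\to[-\infty,\infty]$ is a locally inf-integrable random lsc function (with respect to the distribution of $X^1$), $\pi^n:F\to[0,\infty)$, $n\in\mathbb{N}$, satisfies $\pi^n(f^n)\to0$ for every convergent sequence $\{f^n\in F,n\in\mathbb{N}\}$, and $\delta>0$. If $\{\epsilon^n\geq0,n\in\mathbb{N}\}\to0$, then, almost surely, $$\operatorname{OutLim}\Big(\epsilon^n\text{-}\operatorname{argmin}_{f\in F^n_\delta}\ \frac1n\sum_{j=1}^n\psi(X^j,f)+\pi^n(f)\Big)\subset\Big\{f\in F^\infty_\delta\ \Big|\ \mathbb{E}[\psi(X^1,f)]\leq\inf_{g\in\operatorname{Lim}F^n}\mathbb{E}[\psi(X^1,g)]\Big\},$$ where $F^n_\delta=\{f\in F\mid\inf_{g\in F^n}\mathbf{d}(f,g)\leq\delta\}$ and $F^\infty_\delta=\{f\in F\mid\inf_{g\in\operatorname{Lim}F^n}\mathbf{d}(f,g)\leq\delta\}$. In particular, if $\operatorname{Lim}F^n=F$, then the right-hand side of the inclusion equals $\operatorname{argmin}_{f\in F}\mathbb{E}[\psi(X^1,f)]$.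
   Context: Notation: $\overline{\mathbb{R}}=[-\infty,\infty]$. $\mathrm{usc\text{-}fcns}(S)$ is the set of upper semicontinuous (usc) functions $f:S\to\overline{\mathbb{R}}$ with $f\not\equiv-\infty$. The hypograph is $\operatorname{hypo} f=\{(x,\alpha)\in S\times\mathbb{R}\mid f(x)\geq\alpha\}$. Fix any norm on $\mathbb{R}^d\times\mathbb{R}$ and a point $z^{\rm ctr}\in S\times\mathbb{R}$. The Attouch-Wets (aw) distance is $\mathbf{d}(f,g)=\int_0^\infty \mathbf{d}_\rho(f,g)e^{-\rho}d\rho$, where $\mathbf{d}_\rho(f,g)=\max\{|\operatorname{dist}(z,\operatorname{hypo} f)-\operatorname{dist}(z,\operatorname{hypo} g)| : \|z-z^{\rm ctr}\|\leq\rho\}$ and $\operatorname{dist}$ is the point-to-set distance. Convergence and closedness in $\mathrm{usc\text{-}fcns}(S)$ are with respect to $\mathbf{d}$. Convergence $\mathbf{d}(f^n,f)\to0$ is equivalent to hypo-convergence: $\limsup f^n(x^n)\leq f(x)$ for all $x^n\in S\to x$, and for every $x\in S$ there is $x^n\in S\to x$ with $\liminf f^n(x^n)\geq f(x)$. For a set $G$, $\phi:G\to\overline{\mathbb{R}}$ and $\epsilon\geq0$, $\epsilon\text{-}\operatorname{argmin}_{f\in G}\phi(f)=\{f\in G\mid\phi(f)\leq\inf_{g\in G}\phi(g)+\epsilon\}$, and $\operatorname{argmin}$ is the case $\epsilon=0$. $\phi$ is lsc if $\liminf\phi(f^n)\geq\phi(f)$ whenever $f^n\in G\to f\in G$. The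 infimum over the empty set is $\infty$. Set limits (here in the space $(\mathrm{usc\text{-}fcns}(S),\mathbf{d})$): $\operatorname{OutLim}A^n$ is the collection of points to which a subsequence of some sequence $\{a^n\in A^n\}$ converges; $\operatorname{InnLim}A^n$ is the collection of points to which some sequence $\{a^n\in A^n\}$ converges. If both equal $A$, then $A^n$ set-converges to $A$ and $\operatorname{Lim}A^n=A$. Extended arithmetic: $0\cdot\infty=0$, $\alpha\cdot\infty=\infty$ for $\alpha>0$, $\alpha+\infty=\infty$ for $\alpha\in\overline{\mathbb{R}}$, $\alpha-\infty=-\infty$ for $\alpha\in[-\infty,\infty)$; in particular $\infty-\infty=\infty$, so the integral of any measurable extended real-valued function is well defined. Let $(S^0,\mathcal{B}^0,P^0)$ be a complete probability space with $P^0$ the distribution of $X^1$. $\psi:S^0\times F\to\overline{\mathbb{R}}$ is a random lsc function if $\psi(x,\cdot)$ is lsc for all $x\in S^0$ and $\psi$ is measurable with respect to the product sigma-algebra on $S^0\times F$ (with the Borel sigma-algebra under $\mathbf{d}$ on $F$). It is locally inf-integrable if for all $f\in F$ there exists $\rho>0$ such that $\int\inf_{g\in F}\{\psi(x,g)\mid\mathbf{d}(f,g)\leq\rho\}\,dP^0(x)>-\infty$.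
   Formalization: Local inf-integrability is taken to mean that the negative part of the local infimum of ψ is integrable; under the stated convention ∞−∞=∞ it would also admit infima whose positive and negative parts both have infinite integral, and then the inclusion can fail. *)

(* Defs.v *)
From HB Require Import structures.
From mathcomp Require Import all_boot all_order all_algebra finmap.
From mathcomp Require Import all_classical all_reals all_analysis measurable_realfun.
Set Implicit Arguments.
Unset Strict Implicit.
Unset Printing Implicit Defensive.
Import Order.TTheory GRing.Theory Num.Theory.
Import numFieldNormedType.Exports.
Local Open Scope classical_set_scope.
Local Open Scope ring_scope.

Record norm_on (R : realType) (V : lmodType R) := NormOn {
  norm_on_fun :> V -> R ;
  norm_onD : forall x y, norm_on_fun (x + y) <= norm_on_fun x + norm_on_fun y ;
  norm_onZ : forall (a : R) x, norm_on_fun (a *: x) = `|a| * norm_on_fun x ;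
  norm_on_eq0 : forall x, norm_on_fun x = 0 -> x = 0 }.

(* Measurable types are required to be pointed, whence the proof [A0]. *)
Definition set_ptype (T : Type) (A : set T) (A0 : A !=set0) : Type := A.

Section set_ptype_pointed.
Context (T : choiceType) (A : set T) (A0 : A !=set0).
HB.instance Definition _ := Choice.copy (set_ptype A0) (set_type A).
HB.instance Definition _ := isPointed.Build (set_ptype A0)
  (exist _ (projT1 (cid A0)) (mem_set (projT2 (cid A0)))).
End set_ptype_pointed.

Section usc_fcns.
Context (R : realType) (d : nat) (S : set 'rV[R]_d).
Local Open Scope ereal_scope.

Record usc_fcns := UscFcn {
  usc_fun :> S -> \bar R ;
  usc_funP : lower_semicontinuous (fun x => - usc_fun x) ;
  usc_fun_neqNy : exists x, usc_fun x != -oo }.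

Definition hypo (f : S -> \bar R) : set ('rV[R]_d * R^o) :=
  [set z | exists2 x : S, val x = z.1 & z.2%:E <= f x].

End usc_fcns.

Section aw_distance.
Context (R : realType) (d : nat) (S : set 'rV[R]_d).
Variables (N : norm_on ('rV[R]_d * R^o)%type) (zctr : 'rV[R]_d * R^o).
Implicit Types f g h : usc_fcns S.

Definition set_dist (z : 'rV[R]_d * R^o) (A : set ('rV[R]_d * R^o)) : R :=
  inf [set N (z - w) | w in A].

Definition aw_dist_rho (rho : R) f g : \bar R :=
  ereal_sup [set `|set_dist z (hypo f) - set_dist z (hypo g)|%:E
            | z in [set z | N (z - zctr) <= rho]].

Definition aw_dist f g : \bar R :=
  (\int[lebesgue_measure]_(rho in `[0%R, +oo[)
     (aw_dist_rho rho f g * (expR (- rho))%:E))%E.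

Lemma aw_dist_rho_ge0 rho f g : 0 <= rho -> (0 <= aw_dist_rho rho f g)%E.
Proof.
move=> rho0; apply: (@le_trans _ _
  `|set_dist zctr (hypo f) - set_dist zctr (hypo g)|%:E).
  by rewrite lee_fin.
apply: ereal_sup_ubound; exists zctr => //=; rewrite subrr.
by have := norm_onZ N 0 0; rewrite scale0r normr0 mul0r => ->.
Qed.

Lemma aw_dist_rho_nd rho1 rho2 f g : rho1 <= rho2 ->
  (aw_dist_rho rho1 f g <= aw_dist_rho rho2 f g)%E.
Proof.
move=> r12; apply: ereal_sup_le => _ [z zr <-]; exists z => //=.
exact: le_trans zr r12.
Qed.

Lemma aw_dist_rhoxx rho f : 0 <= rho -> aw_dist_rho rho f f = 0%E.
Proof.
move=> rho0; apply/eqP; rewrite eq_le aw_dist_rho_ge0// andbT.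
by apply: ge_ereal_sup => _ [z _ <-]; rewrite subrr normr0.
Qed.

Lemma aw_dist_rho_sym rho f g : aw_dist_rho rho f g = aw_dist_rho rho g f.
Proof.
by rewrite /aw_dist_rho; congr (ereal_sup _); apply/seteqP; split => _ [z zr <-];
  exists z => //; rewrite distrC.
Qed.

Lemma aw_dist_rho_triangle rho g f h : 0 <= rho ->
  (aw_dist_rho rho f h <= aw_dist_rho rho f g + aw_dist_rho rho g h)%E.
Proof.
move=> rho0; apply: ge_ereal_sup => _ [z zr <-].
apply: (@le_trans _ _ (`|set_dist z (hypo f) - set_dist z (hypo g)|%:E +
                       `|set_dist z (hypo g) - set_dist z (hypo h)|%:E)%E).
  by rewrite -EFinD lee_fin ler_distD.
by apply: leeD; apply: ereal_sup_ubound; exists z.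
Qed.

Lemma measurable_aw_integrand f g : measurable_fun (`[0%R, +oo[%classic : set (measurableTypeR R))
  ((fun rho => (aw_dist_rho rho f g * (expR (- rho))%:E)%E) :
    measurableTypeR R -> \bar R).
Proof.
apply: emeasurable_funM; last first.
  apply/measurable_EFinP; apply: measurable_funTS.
  apply: measurableT_comp => //; exact: measurableT_comp.
apply: measurable_funTS.
apply: (measurability _ (ErealGenCInfty.measurableE R)) => //.
move=> _ [_ [a ->] <-]; rewrite setTI; apply: is_interval_measurable.
move=> s t /=; rewrite !in_itv/= !andbT => fs _ u /andP[su _].
by rewrite in_itv/= andbT (le_trans fs)// aw_dist_rho_nd.
Qed.

Lemma aw_integrand_ge0 f g rho : `[0%R, +oo[%classic (rho : R) ->
  (0 <= aw_dist_rho rho f g * (expR (- rho))%:E)%E.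
Proof.
rewrite /= in_itv/= andbT => rho0.
by rewrite mule_ge0// ?aw_dist_rho_ge0// lee_fin expR_ge0.
Qed.

Lemma aw_distxx f : aw_dist f f = 0%E.
Proof.
apply: integral0_eq => rho; rewrite /= in_itv/= andbT => rho0.
by rewrite aw_dist_rhoxx// mul0e.
Qed.

Lemma aw_dist_sym f g : aw_dist f g = aw_dist g f.
Proof. by apply: eq_integral => rho _; rewrite aw_dist_rho_sym. Qed.

Lemma aw_dist_triangle g f h :
  (aw_dist f h <= aw_dist f g + aw_dist g h)%E.
Proof.
rewrite /aw_dist -ge0_integralD//=; [|exact: aw_integrand_ge0|
  exact: measurable_aw_integrand|exact: aw_integrand_ge0|
  exact: measurable_aw_integrand].
apply: ge0_le_integral => //.
- exact: aw_integrand_ge0.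
- exact: measurable_aw_integrand.
- by apply: emeasurable_funD; exact: measurable_aw_integrand.
- move=> rho; rewrite /= in_itv/= andbT => rho0.
  rewrite -ge0_muleDl ?aw_dist_rho_ge0//; apply: lee_wpmul2r.
    by rewrite lee_fin expR_ge0.
  exact: aw_dist_rho_triangle.
Qed.

End aw_distance.

(* [usc_fcns S] as a pseudometric space, with the topology of [aw_dist]. *)
Definition aw_space (R : realType) (d : nat)
    (N : norm_on ('rV[R]_d * R^o)%type) (zctr : 'rV[R]_d * R^o)
    (S : set 'rV[R]_d) (Sne : S !=set0) : Type := usc_fcns S.

Section aw_space_instances.
Context (R : realType) (d : nat) (N : norm_on ('rV[R]_d * R^o)%type).
Context (zctr : 'rV[R]_d * R^o) (S : set 'rV[R]_d) (Sne : S !=set0).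
Local Notation U := (aw_space N zctr Sne).

Definition aw_ball (f : U) (r : R) : set U :=
  [set g | (aw_dist N zctr f g < r%:E)%E].

Lemma aw_ball_center (f : U) (e : R) : 0 < e -> aw_ball f e f.
Proof. by move=> e0; rewrite /aw_ball /= aw_distxx lte_fin. Qed.

Lemma aw_ball_sym (f g : U) (e : R) : aw_ball f e g -> aw_ball g e f.
Proof. by rewrite /aw_ball /= aw_dist_sym. Qed.

Lemma aw_ball_triangle (f g h : U) (e1 e2 : R) :
  aw_ball f e1 g -> aw_ball g e2 h -> aw_ball f (e1 + e2) h.
Proof.
rewrite /aw_ball /= => fg gh.
apply: le_lt_trans (aw_dist_triangle N zctr g f h) _.
by rewrite EFinD; exact: lteD.
Qed.

Lemma cst0_usc : lower_semicontinuous (fun _ : S => - (0 : \bar R))%E.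
Proof. by move=> x a a0; exists setT => //; exact: filterT. Qed.

Lemma cst0_neqNy : exists x : S, (0 : \bar R)%E != -oo%E.
Proof. by case: Sne => x Sx; exists (exist _ x (mem_set Sx)). Qed.

HB.instance Definition _ := gen_eqMixin U.
HB.instance Definition _ := gen_choiceMixin U.
HB.instance Definition _ := isPointed.Build U (UscFcn cst0_usc cst0_neqNy).
HB.instance Definition _ := hasNbhs.Build U (nbhs_ (entourage_ aw_ball)).
HB.instance Definition _ := @Nbhs_isPseudoMetric.Build R U
  (entourage_ aw_ball) erefl aw_ball aw_ball_center aw_ball_sym
  aw_ball_triangle erefl.

Lemma aw_space_ballE (f : U) (r : R) :
  ball f r = [set g : U | (aw_dist N zctr f g < r%:E)%E].
Proof. by []. Qed.

End aw_space_instances.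

(* Outer and inner limits in the sense of Painleve-Kuratowski, so that a few
   empty [A n] do not make the limits empty. When no [A n] is empty, [a] in
   [outer_lim] is the subsequence along [phi] of a sequence with terms in
   [A n] for all n, and [inner_lim] may equally require [A n (a n)] for all n. *)
Section set_limits.
Context (U : topologicalType).
Implicit Types A : nat -> set U.

Definition outer_lim A : set U :=
  [set f | exists (phi : nat -> nat) (a : nat -> U),
    [/\ {homo phi : i j / (i < j)%N}, forall k, A (phi k) (a k) &
        a k @[k --> \oo] --> f]].

Definition inner_lim A : set U :=
  [set f | exists a : nat -> U,
    (\forall n \near \oo, A n (a n)) /\ a n @[n --> \oo] --> f].

Definition set_converges A (L : set U) := outer_lim A = L /\ inner_lim A = L.

End set_limits.

Section eps_argmin.
Context (R : realType) (T : Type).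
Local Open Scope ereal_scope.

Definition eps_argmin (eps : R) (G : set T) (phi : T -> \bar R) : set T :=
  [set f | G f /\ phi f <= ereal_inf [set phi g | g in G] + eps%:E].

Definition argmin (G : set T) (phi : T -> \bar R) : set T := eps_argmin 0 G phi.

End eps_argmin.

(* The integral under the convention +oo - oo = +oo, which is that of the
   addition of [ereal_dual_scope]; in [\int], +oo - oo = -oo. *)
Definition ext_integral d (T : measurableType d) (R : realType)
    (mu : set T -> \bar R) (h : T -> \bar R) : \bar R :=
  ((\int[mu]_x h^\+ x)%E - (\int[mu]_x h^\- x)%E)%dE.

Section iid.
Context (d d' : measure_display) (Omega : measurableType d).
Context (T : measurableType d') (R : realType) (P : probability Omega R).
Implicit Types X : nat -> {mfun Omega >-> T}.
Local Open Scope ereal_scope.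

Definition mutually_independent X := forall (J : {fset nat}) (A : nat -> set T),
  (forall j, measurable (A j)) ->
  P (\bigcap_(j in [set` J]) X j @^-1` A j) =
  \prod_(j <- J) P (X j @^-1` A j).

Definition identically_distributed X := forall j (A : set T), measurable A ->
  distribution P (X j) A = distribution P (X 0%N) A.

Definition iid X := mutually_independent X /\ identically_distributed X.

End iid.

Section random_lsc.
Context (R : realType) (d0 : measure_display) (T0 : measurableType d0).
Context (d : nat) (N : norm_on ('rV[R]_d * R^o)%type).
Context (zctr : 'rV[R]_d * R^o) (S : set 'rV[R]_d) (Sne : S !=set0).
Local Notation U := (aw_space N zctr Sne).
Implicit Types (F : set U) (psi : T0 -> U -> \bar R).
Local Open Scope ereal_scope.

Definition lsc_on F (phi : U -> \bar R) := forall (u : nat -> U) (f : U),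
  (forall n, F (u n)) -> F f -> u n @[n --> \oo] --> f ->
  phi f <= limn_einf (fun n => phi (u n)).

Definition random_lsc F psi :=
  (forall x, lsc_on F (psi x)) /\
  measurable_fun (setT `*` F : set (T0 * g_sigma_algebraType (@open U)))
    (fun xf => psi xf.1 xf.2).

(* [\int] is meant here, and not [ext_integral], for which the condition would
   also hold when the positive and negative parts of the infimum both have
   infinite integral. It says that the negative part of the infimum is
   integrable; then so is that of psi(., f) for all f in F, and no +oo - oo
   occurs in their expectations. *)
Definition locally_inf_integrable (mu : set T0 -> \bar R) F psi :=
  forall f, F f -> exists2 rho : R, (0 < rho)%R &
    -oo < \int[mu]_x ereal_inf
      [set psi x g | g in F `&` [set g | aw_dist N zctr f g <= rho%:E]].

Definition aw_thicken F (delta : R) (G : set U) : set U :=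
  [set f | F f /\
    ereal_inf [set aw_dist N zctr f g | g in G] <= delta%:E].

End random_lsc.

(* Main.v *)
Require Import Defs.
From HB Require Import structures.
From mathcomp Require Import all_boot all_order all_algebra finmap.
From mathcomp Require Import ring lra.
From mathcomp Require Import all_classical all_reals all_analysis measurable_realfun.
Set Implicit Arguments.
Unset Strict Implicit.
Unset Printing Implicit Defensive.
Import Order.TTheory GRing.Theory Num.Theory.
Import numFieldNormedType.Exports.
Local Open Scope classical_set_scope.
Local Open Scope ring_scope.

(** The law of large numbers is applied to countably many functions. For the
    upper bound these are [psi(., g)] for a minimizing sequence of [g]'s in the
    set limit, each of which eventually lies in the thickened constraint sets.
    For the lower bound these are infima of [psi] over small balls; the
    Attouch-Wets space is separable, and since these infima increase to
    [psi(., f)], some ball near [f] has one with mean above any [c < E f]. The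
    infima are measurable by the measurable projection theorem: the space is
    complete and separable, so the projection is a Suslin set, and the
    distribution is complete. The strong law itself is Etemadi's, along the
    subsequences [c * 2 ^ n]. Finally, cluster points stay in the thickening of
    the set limit because bounded sequences of hypographs have convergent
    subsequences. *)

(** * Suslin operation and measurable projections *)

(** A hypograph enters the distance only through its distance function, which is 1-Lipschitz. Facts
    about the space thus become facts about 1-Lipschitz functions on a finite-dimensional space,
    once locally uniform limits of distance functions to hypographs are shown to be of the same
    kind.

    Since [psi x] is merely lower semicontinuous, an infimum over a ball cannot be taken along a
    dense sequence, whence the projections. For the same reason the averages have no upper bound
    along a sequence converging to [g]. The assumption [delta > 0] makes up for this: a point [g] of
    the set limit is itself feasible from some index on, and the law at that single [g] suffices.

    Means may be [+oo], so lower bounds are obtained for functions truncated from above. Rational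
    levels strictly between the infimum and the mean cover infinite values and let one null set
    serve all levels. *)

Section suslin_operation.
Context (T : Type).
Implicit Types (E : seq nat -> set T) (s : seq nat).

Definition suslin E : set T :=
  [set x | exists u : nat -> nat, forall n, E (mkseq u n) x].

(** Branches through the node [s]. These sets decompose exactly over the children of [s], which
    [E s] need not do, so hulls are taken of them. *)
Definition suslin_at E s : set T :=
  [set x | exists u : nat -> nat,
    mkseq u (size s) = s /\ forall n, E (mkseq u n) x].

Lemma suslin_at_nil E : suslin_at E [::] = suslin E.
Proof. by apply/seteqP; split=> x [u]; [case=> _ h|move=> h]; exists u. Qed.

Lemma suslin_at_sub E s : suslin_at E s `<=` E s.
Proof. by move=> x [u [<-]]; exact. Qed.

Lemma suslin_at_rcons E s :
  suslin_at E s = \bigcup_k suslin_at E (rcons s k).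
Proof.
apply/seteqP; split=> [x [u [us ux]]|x [k _ [u [us ux]]]].
  by exists (u (size s)) => //; exists u; rewrite size_rcons mkseqS us.
exists u; split=> //; move: us; rewrite size_rcons mkseqS.
by move=> /eqP; rewrite eqseq_rcons => /andP[/eqP].
Qed.

End suslin_operation.

Section complete_probability.
Context d (T : measurableType d) (R : realType) (P : probability T R).

(** Intersecting measurable supersets whose measures tend to the infimum attains it. If [H'] missed
    some mass of [H], the intersection of both would fall below that infimum. *)
Lemma measurable_hull (X : set T) : exists H, [/\ measurable H, X `<=` H &
  forall H', measurable H' -> X `<=` H' -> P (H `\` H') = 0%E].
Proof.
pose C := [set P B | B in [set B | measurable B /\ X `<=` B]].
have C0 : lbound C 0%E by move=> _ [B _ <-].
have Cfin : ereal_inf C \is a fin_num.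
  rewrite ge0_fin_numE; last exact: le_ereal_inf_tmp.
  apply: (@le_lt_trans _ _ (P setT)); last by rewrite probability_setT ltry.
  by apply: ereal_inf_lbound; exists setT.
have /choice[B BP] : forall n : nat, exists B, [/\ measurable B, X `<=` B &
    (P B <= ereal_inf C + (n.+1%:R^-1)%:E)%E].
  move=> n; have n0 : 0 < n.+1%:R^-1 :> R by rewrite invr_gt0.
  have [_ [B [mB XB] <-] /ltW PB] := lb_ereal_inf_adherent n0 Cfin.
  by exists B.
have mH : measurable (\bigcap_n B n).
  by apply: bigcapT_measurable => n; have [] := BP n.
have XH : X `<=` \bigcap_n B n by move=> x Xx n _; have [_ /(_ x Xx)] := BP n.
exists (\bigcap_n B n); split => // H' mH' XH'.
set H := \bigcap_n B n in mH XH *.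
have PHle : (P H <= ereal_inf C)%E.
  apply/lee_addgt0Pr => e e0.
  near \oo => n.
  have [mB _ PB] := BP n.
  apply: (@le_trans _ _ (P (B n))); first by rewrite le_measure ?inE//; exact: bigcap_inf.
  apply: (le_trans PB); rewrite leeD2l// lee_fin ltW//.
  by near: n; exact: near_infty_natSinv_lt (PosNum e0).
have PHH' : (P H <= P (H `&` H'))%E.
  apply: (le_trans PHle); apply: ereal_inf_lbound; exists (H `&` H') => //.
  by split; [exact: measurableI|move=> x Xx; split; [exact: XH|exact: XH']].
apply/eqP; rewrite -measure_le0 measureD//; last first.
  by rewrite (le_lt_trans (probability_le1 _ _))// ltry.
by rewrite leeBlDr ?add0e// fin_num_measure//; exact: measurableI.
Unshelve. all: by end_near. Qed.

(* With [H s] a measurable hull of [suslin_at E s] inside [E s], each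
   [H s `\` \bigcup_k H (rcons s k)] is null, and a point of [H [::]] outside
   all of these null sets lies in [H] along an infinite branch. *)
Lemma measurable_suslin (E : seq nat -> set T) : measure_is_complete P ->
  (forall s, measurable (E s)) -> measurable (suslin E).
Proof.
move=> cP mE.
have /choice[H0 H0P] := fun s => measurable_hull (suslin_at E s).
pose H s := H0 s `&` E s.
have mH s : measurable (H s) by apply: measurableI => //; have [] := H0P s.
have sH s : suslin_at E s `<=` H s.
  move=> x Ex; split; last exact: suslin_at_sub Ex.
  by have [_ + _] := H0P s; exact.
pose N s := H s `\` \bigcup_k H (rcons s k).
have mU s : measurable (\bigcup_k H (rcons s k)) by exact: bigcupT_measurable.
have mN s : measurable (N s) by exact: measurableD.
have N0 s : P (N s) = 0%E.
  have [mH0 _ minH] := H0P s.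
  apply/eqP; rewrite -measure_le0 -(minH (\bigcup_k H (rcons s k))) => //.
    rewrite le_measure ?inE//; first exact: measurableD.
    by apply: setSD; exact: subIsetl.
  by rewrite suslin_at_rcons; exact: subset_bigcup.
have negN : P.-negligible (H [::] `\` suslin E).
  have negU : P.-negligible (\bigcup_k N (CodeSeq.decode k)).
    by apply: negligible_bigcup => k; apply/(negligibleP _ (mN _)); exact: N0.
  apply: negligibleS negU => x [Hx nEx]; apply: contrapT => nNx; apply: nEx.
  have step s : H s x -> exists k, H (rcons s k) x.
    move=> Hsx; apply: contrapT => nk; apply: nNx.
    exists (CodeSeq.code s) => //; rewrite CodeSeq.codeK; split => // -[k _ Hk].
    by apply: nk; exists k.
  have /choice[f fP] : forall s, exists k, H s x -> H (rcons s k) x.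
    by move=> s; have [/step[k]|] := pselect (H s x); [exists k|exists 0%N].
  pose b := fix b n := if n is n'.+1 then rcons (b n') (f (b n')) else [::].
  have Hb n : H (b n) x by elim: n => //= n; exact: fP.
  exists (fun n => f (b n)) => n.
  suff -> : mkseq (fun n => f (b n)) n = b n by case: (Hb n).
  by elim: n => //= n IH; rewrite mkseqS IH.
(* Completeness enters here: the set removed from the hull at the root is negligible, hence
   measurable. *)
have -> : suslin E = H [::] `\` (H [::] `\` suslin E).
  rewrite setDD; apply/esym/setIidr; rewrite -suslin_at_nil; exact: sH.
by apply: measurableD => //; exact: cP.
Qed.

End complete_probability.

Lemma map_mkseq_comp (A B : Type) (f : A -> B) (u : nat -> A) n :
  map f (mkseq u n) = mkseq (f \o u) n.
Proof. by rewrite /mkseq -map_comp. Qed.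

Lemma take_mkseq (A : Type) (u : nat -> A) k n : (k <= n)%N ->
  take k (mkseq u n) = mkseq u k.
Proof. by move=> kn; rewrite /mkseq -map_take take_iota (minn_idPl kn). Qed.

(** * Suslin sets over rectangles with measurable and closed sides *)

Section closed_suslin.
Context d (T : measurableType d) (R : realType) (U : pseudoPMetricType R).
Implicit Types (A : set (T * U)).

(** Closedness of the sides in [U] keeps a limit of points chosen along a branch inside each side;
    this is how a witness for the projection is recovered. *)
Definition closed_suslin A := exists (B : seq nat -> set T) (C : seq nat -> set U),
  [/\ forall s, measurable (B s), forall s, closed (C s) &
      A = suslin (fun s => B s `*` C s)].

Lemma closed_suslin_rect (B : set T) (C : set U) :
  measurable B -> closed C -> closed_suslin (B `*` C).
Proof.
move=> mB cC; exists (fun=> B), (fun=> C); split => //.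
by apply/seteqP; split=> [z zBC|z [u /(_ 0%N)]//]; exists id.
Qed.

(** The first entry of a branch selects the set, the rest is a branch of it; the empty prefix
    imposes nothing, whence [setT]. *)
Lemma closed_suslin_bigcup (A : nat -> set (T * U)) :
  (forall n, closed_suslin (A n)) -> closed_suslin (\bigcup_n A n).
Proof.
move=> /choice[B /choice[C ABC]].
exists (fun s => if s is i :: s' then B i s' else setT),
       (fun s => if s is i :: s' then C i s' else setT); split.
- by case=> [|i s]//; have [] := ABC i.
- by case=> [|i s]; [exact: closedT|have [] := ABC i].
have mkE (u : nat -> nat) n : mkseq u n.+1 = u 0%N :: mkseq (u \o succn) n.
  by rewrite /mkseq/= -[iota 1 n]/(iota (1 + 0) n) iotaDl -map_comp.
apply/seteqP; split=> [z [i _]|z [u zu]].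
  have [_ _ ->] := ABC i => -[u zu].
  exists (fun n => if n is n'.+1 then u n' else i) => -[//|n].
  by rewrite mkE/=; exact: zu.
exists (u 0%N) => //; have [_ _ ->] := ABC (u 0%N).
by exists (u \o succn) => n; have := zu n.+1; rewrite mkE.
Qed.

(* A branch of the intersection codes one branch of each [A i]: the [k]th entry
   of the latter sits at position [pickle (i, k)]. *)
Lemma closed_suslin_bigcap (A : nat -> set (T * U)) :
  (forall n, closed_suslin (A n)) -> closed_suslin (\bigcap_n A n).
Proof.
move=> /choice[B /choice[C ABC]].
pose pos (i k : nat) := choice.pickle (i, k).
pose br (i n : nat) (s : seq nat) := mkseq (fun k => nth 0%N s (pos i k)) n.
(* The lengths [n] for which [s] already holds the first [n] entries of branch [i]: there [br i n s]
   never reads the default of [nth]. *)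
pose def (i : nat) (s : seq nat) : set nat := [set n | forall k, (k < n)%N -> (pos i k < size s)%N].
exists (fun s => \bigcap_i \bigcap_(n in def i s) B i (br i n s)),
       (fun s => \bigcap_i \bigcap_(n in def i s) C i (br i n s)); split.
- move=> s; apply: bigcapT_measurable => i.
  by apply: bigcap_measurableType => n _; have [] := ABC i.
- move=> s; apply: closed_bigI => i _.
  by apply: closed_bigI => n _; have [] := ABC i.
apply/seteqP; split=> [z zA|z [u zu] i _].
  have /choice[v vP] : forall i, exists v, forall n,
      (B i (mkseq v n) `*` C i (mkseq v n)) z.
    by move=> i; have := zA i I; have [_ _ ->] := ABC i => -[v]; exists v.
  pose u m := if choice.unpickle m is Some (i, k) then v i k else 0%N.
  have bru i n m : def i (mkseq u m) n -> br i n (mkseq u m) = mkseq (v i) n.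
    rewrite /def/= size_mkseq => dn; apply: (@eq_from_nth _ 0%N).
      by rewrite !size_mkseq.
    rewrite size_mkseq => k kn.
    by rewrite !nth_mkseq ?dn// /u choice.pickleK.
  by exists u => m; split => i _ n dn; rewrite bru//; have [] := vP i n.
have [_ _ ->] := ABC i; exists (fun k => u (pos i k)) => n.
pose m := (\max_(k < n) (pos i k).+1)%N.
have dm : def i (mkseq u m) n.
  by move=> k kn; rewrite size_mkseq; exact: (leq_bigmax (Ordinal kn)).
have bru : br i n (mkseq u m) = mkseq (fun k => u (pos i k)) n.
  apply: (@eq_from_nth _ 0%N); first by rewrite !size_mkseq.
  rewrite size_mkseq => k kn; rewrite !nth_mkseq//.
  by have := dm k kn; rewrite size_mkseq.
by have [/(_ i I n dm) + /(_ i I n dm)] := zu m; rewrite bru.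
Qed.

(** Open sets are F-sigma: [C n] keeps the points away from the complement. Interiors are removed
    because the axioms of a pseudometric ball do not make it open. *)
Lemma open_bigcup_closed (D : set U) : open D ->
  exists C : nat -> set U, (forall n, closed (C n)) /\ D = \bigcup_n C n.
Proof.
move=> oD.
exists (fun n => ~` \bigcup_(z in ~` D) (ball z n.+1%:R^-1)°); split => [n|].
  by rewrite closedC; apply: bigcup_open => z _; exact: open_interior.
apply/seteqP; split=> [y Dy|y [n _ yC]]; last first.
  apply: contrapT => nDy; apply: yC; exists y => //.
  by apply: nbhsx_ballx; rewrite invr_gt0.
have /nbhs_ballP[e /= e0 eD] := open_nbhs_nbhs (conj oD Dy).
near \oo => n; exists n => // -[z nDz /interior_subset zy].
apply: nDz; apply: eD; apply: (le_ball (ltW _) (ball_sym zy)).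
by near: n; exact: near_infty_natSinv_lt (PosNum e0).
Unshelve. all: by end_near. Qed.

(** Suslin sets are in general not stable under complements; carrying the complement along gives a
    sigma-algebra. *)
Let bisuslin A := closed_suslin A /\ closed_suslin (~` A).

Let bisuslin_setC A : bisuslin A -> bisuslin (~` A).
Proof. by rewrite /bisuslin setCK => -[]. Qed.

Let bisuslin_bigcup (A : nat -> set (T * U)) :
  (forall n, bisuslin (A n)) -> bisuslin (\bigcup_n A n).
Proof.
move=> bA; split; first by apply: closed_suslin_bigcup => n; case: (bA n).
by rewrite setC_bigcup; apply: closed_suslin_bigcap => n; case: (bA n).
Qed.

Let bisuslin_fst (B : set T) : measurable B -> bisuslin (B `*` setT).
Proof.
move=> mB; split; first exact: closed_suslin_rect closedT.
rewrite (_ : ~` _ = ~` B `*` setT).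
  by apply: closed_suslin_rect closedT; exact: measurableC.
by apply/seteqP; split=> [z /= nz|z /= [nz _] []//]; split=> // Bz; exact: nz.
Qed.

Let bisuslin_snd (D : set U) : <<s open >> D -> bisuslin (setT `*` D).
Proof.
move: D; suff : sigma_algebra setT [set D : set U | bisuslin (setT `*` D)] /\
    open `<=` [set D : set U | bisuslin (setT `*` D)].
  by move=> [sD oD]; exact: (smallest_sub sD oD).
have CE (D : set U) : ~` (setT `*` D) = setT `*` (~` D) :> set (T * U).
  by apply/seteqP; split=> [z /= nz|z /= [_ nz] []//]; split=> // Bz; exact: nz.
split; first split.
- by rewrite /= setX0 -(set0X setT); exact: bisuslin_fst.
- by move=> D /=; rewrite setTD -CE; exact: bisuslin_setC.
- by move=> D /= bD; rewrite setX_bigcupr; exact: bisuslin_bigcup.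
move=> D oD /=; split; last first.
  by rewrite CE; apply: closed_suslin_rect => //; exact: open_closedC.
have [C [cC ->]] := open_bigcup_closed oD.
by rewrite setX_bigcupr; apply: closed_suslin_bigcup => n; exact: closed_suslin_rect.
Qed.

Lemma measurable_closed_suslin (A : set (T * g_sigma_algebraType (@open U))) :
  measurable A -> closed_suslin A.
Proof.
move=> mA; suff [] : bisuslin A by [].
move: A mA; apply: smallest_sub; first split.
- by rewrite -(set0X setT); exact: bisuslin_fst.
- by move=> D; rewrite setTD; exact: bisuslin_setC.
- exact: bisuslin_bigcup.
move=> A [|] [B mB <-]; rewrite setTI.
  rewrite (_ : _ @^-1` _ = B `*` setT); first exact: bisuslin_fst.
  by apply/seteqP; split=> z //= [].
rewrite (_ : _ @^-1` _ = setT `*` B); first exact: bisuslin_snd.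
by apply/seteqP; split=> z //= [].
Qed.

End closed_suslin.

(** * Projection along a complete separable factor *)

Section measurable_projection.
Context d (T : measurableType d) (R : realType) (P : probability T R).
Context (U : pseudoPMetricType R) (F : set U).
Hypothesis P_complete : measure_is_complete P.
Hypothesis F_complete : forall u : nat -> U, (forall n, F (u n)) ->
  (forall e, 0 < e -> exists M, forall m n, (M <= m)%N -> (M <= n)%N ->
    ball (u m) e (u n)) ->
  exists2 l, F l & u n @[n --> \oo] --> l.
Variable K : nat -> nat -> set U.
Hypothesis K_cover : forall k x, F x -> exists i, K k i x.
Hypothesis K_small : forall k i x y,
  K k i x -> K k i y -> ball x k.+1%:R^-1 y.

(* Intersecting the closed sides of the rectangles with smaller and smaller
   pieces of [F] makes them nested with vanishing diameter, so that by
   completeness the projection is again given by a Suslin scheme. *)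
Lemma measurable_projection (A : set (T * g_sigma_algebraType (@open U))) :
  measurable A -> measurable [set x | exists2 f, F f & A (x, f)].
Proof.
move=> /measurable_closed_suslin[B [C [mB cC AE]]].
(* Each entry codes a pair: an entry of a branch of [A] and the index of a piece of [F]. The default
   serves numbers that code no pair. *)
pose dec n := odflt (0, 0)%N (choice.unpickle n : option (nat * nat)).
pose s1 s := map (fst \o dec) s; pose s2 s := map (snd \o dec) s.
pose meets s y := [/\ F y, forall k, (k <= size s)%N -> C (take k (s1 s)) y &
  forall k, (k < size s)%N -> K k (nth 0%N (s2 s) k) y].
(* Whether a witness exists does not depend on [x], so [E s] is measurable. *)
pose E s := if `[< exists y, meets s y >] then B (s1 s) else set0.
have mE s : measurable (E s) by rewrite /E; case: ifP.
suff -> : [set x | exists2 f, F f & A (x, f)] = suslin E.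
  exact: (measurable_suslin P_complete mE).
apply/seteqP; split=> [x [f Ff]|x [u ux]].
  rewrite AE => -[v vP].
  have /choice[w wP] := fun k => K_cover k Ff.
  pose u n := choice.pickle (v n, w n); exists u => n.
  have u1 m : s1 (mkseq u m) = mkseq v m.
    rewrite /s1 map_mkseq_comp; apply: eq_map => k.
    by rewrite /= /u /dec choice.pickleK.
  have u2 m : s2 (mkseq u m) = mkseq w m.
    rewrite /s2 map_mkseq_comp; apply: eq_map => k.
    by rewrite /= /u /dec choice.pickleK.
  rewrite /E; case: asboolP => [_|]; first by rewrite u1; case: (vP n).
  case; exists f; split=> // k; rewrite size_mkseq => kn.
    by rewrite u1 take_mkseq//; case: (vP k).
  by rewrite u2 nth_mkseq.
pose v := fst \o dec \o u; pose w := snd \o dec \o u.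
have /choice[y yP] : forall n, exists y, meets (mkseq u n) y /\ B (mkseq v n) x.
  move=> n; have := ux n; rewrite /E; case: asboolP => // -[y my] Bx.
  by exists y; split=> //; move: Bx; rewrite /s1 map_mkseq_comp.
have yK n k : (k < n)%N -> K k (w k) (y n).
  move=> kn; have [[_ _ /(_ k) +] _] := yP n.
  by rewrite size_mkseq /s2 map_mkseq_comp nth_mkseq//; exact.
have yC n k : (k <= n)%N -> C (mkseq v k) (y n).
  move=> kn; have [[_ /(_ k) + _] _] := yP n.
  by rewrite size_mkseq /s1 map_mkseq_comp take_mkseq//; exact.
(* From index [k.+1] on all witnesses share the piece [K k (w k)], so they form a Cauchy
   sequence. *)
have [n|e e0|l Fl yl] := F_complete (u := y); first by have [[]] := yP n.
  have [k ke] : exists k, k.+1%:R^-1 <= e.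
    near \oo => k; exists k; apply: ltW.
    by near: k; exact: near_infty_natSinv_lt (PosNum e0).
  exists k.+1 => m n km kn; apply: (le_ball ke).
  exact: K_small (yK _ _ km) (yK _ _ kn).
exists l => //; rewrite AE; exists v => n; split; first by have [_] := yP n.
apply: (closed_cvg _ (cC _) _ _ yl).
by exists n => // m /= nm; exact: yC.
Unshelve. all: by end_near. Qed.

End measurable_projection.

(** * Geometry of the Attouch-Wets distance *)

Section norm_on_product.
Context (R : realType) (d : nat).
Local Notation V := ('rV[R]_d * R^o)%type.
Variable N : norm_on V.

Lemma norm_on0 : N 0 = 0.
Proof. by rewrite -[0 in LHS](scale0r (0 : V)) norm_onZ normr0 mul0r. Qed.

Lemma norm_onN x : N (- x) = N x.
Proof. by rewrite -scaleN1r norm_onZ normrN1 mul1r. Qed.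

Lemma norm_onB x y : N (x - y) = N (y - x).
Proof. by rewrite -norm_onN opprB. Qed.

Lemma norm_on_ge0 x : 0 <= N x.
Proof.
have := norm_onD N x (- x); rewrite subrr norm_on0 norm_onN.
by rewrite -mulr2n pmulrn_lge0.
Qed.

Lemma norm_on_dist_triangle y x z : N (x - z) <= N (x - y) + N (y - z).
Proof. by rewrite -[x - z](subrKA y); exact: norm_onD. Qed.

Lemma norm_on_sum n (F : 'I_n -> V) : N (\sum_(i < n) F i) <= \sum_(i < n) N (F i).
Proof.
elim/big_ind2 : _ => //; first by rewrite norm_on0.
by move=> x1 x2 y1 y2 h1 h2; apply: (le_trans (norm_onD _ _ _)); exact: lerD.
Qed.

Lemma coord_le_norm (v : 'rV[R]_d) i : `|v 0 i| <= `|v|.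
Proof.
rewrite [leRHS]/Num.norm/= mx_normrE.
exact: (@le_bigmax _ _ _ 0 (fun ij => `|v ij.1 ij.2|) (0, i)).
Qed.

(** Expansion in the standard basis gives the sum of the norms of the basis vectors; the added 1
    makes the constant positive. *)
Lemma norm_on_le_norm : exists2 C, 0 < C & forall x : V, N x <= C * `|x|.
Proof.
exists (\sum_(i < d) N (delta_mx 0 i, 0) + N (0, 1) + 1).
  by rewrite ltr_wpDl// addr_ge0 ?norm_on_ge0// sumr_ge0// => i _; exact: norm_on_ge0.
move=> [v t].
have vtE : ((v, t) : V) = \sum_(i < d) v 0 i *: ((delta_mx 0 i, 0) : V) + t *: ((0, 1) : V).
  have -> : \sum_(i < d) v 0 i *: ((delta_mx 0 i, 0) : V) = (v, 0).
    rewrite [v in RHS]row_sum_delta.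
    elim/big_ind2 : _ => // [x1 x2 y1 y2 -> ->|i _].
      by congr pair; rewrite addr0.
    by congr pair; rewrite scaler0.
  by congr pair => /=; rewrite ?scaler0 ?addr0 ?add0r// /GRing.scale/= mulr1.
rewrite [in leLHS]vtE; apply: (le_trans (norm_onD _ _ _)); rewrite norm_onZ.
have vle : `|v| <= `|(v, t) : V| by rewrite [leRHS]/Num.norm/= le_max lexx.
have tle : `|t| <= `|(v, t) : V| by rewrite [leRHS]/Num.norm/= le_max lexx orbT.
rewrite mulrDl mulrDl mul1r -addrA lerD//.
  apply: (le_trans (norm_on_sum _)); rewrite mulr_suml; apply: ler_sum => i _.
  rewrite norm_onZ mulrC ler_wpM2l ?norm_on_ge0//.
  exact: le_trans (coord_le_norm v i) vle.
by rewrite mulrC -[leLHS]addr0 lerD// ler_wpM2l// norm_on_ge0.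
Qed.

Lemma compact_norm_le (r : R) : compact [set x : V | `|x| <= r].
Proof.
pose box : set V := [set v : 'rV[R]_d | forall i, `[- r, r]%classic (v ord0 i)]
  `*` (`[- r, r]%classic : set R).
have cbox : compact box.
  apply: compact_setX; last exact: segment_compact.
  by apply: (@rV_compact R d (fun=> `[- r, r]%classic)) => i; exact: segment_compact.
apply: (subclosed_compact _ cbox).
  apply: (preimage_closed _ (@closed_le R r)) => x _.
  exact: norm_continuous.
move=> [v t] /=; rewrite [leLHS]/Num.norm/= ge_max => /andP[vr tr]; split=> /=.
  by move=> i; rewrite /= in_itv/= -ler_norml; exact: le_trans (coord_le_norm v i) vr.
by rewrite in_itv/= -ler_norml.
Qed.

Lemma norm_on_continuous : continuous (N : V -> R).
Proof.
have [C C0 NC] := norm_on_le_norm.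
move=> x; apply/cvgrPdist_le => /= e e0.
near=> y.
have xy : N (x - y) <= e.
  apply: (le_trans (NC _)); rewrite -ler_pdivlMl//.
  by near: y; apply: cvgr_dist_le => //; rewrite mulr_gt0// invr_gt0.
rewrite ler_norml; apply/andP; split.
  have := norm_onD N (y - x) x; rewrite subrK norm_onB; lra.
have := norm_onD N (x - y) y; rewrite subrK; lra.
Unshelve. all: by end_near. Qed.

(** The values of [N] on the unit sphere of the maximum norm form a compact set missing 0; the
    radius of a ball around 0 that avoids it is the constant. *)
Lemma norm_le_norm_on : exists2 c, 0 < c & forall x : V, c * `|x| <= N x.
Proof.
pose sph : set V := [set x | `|x| = 1].
have csph : compact sph.
  apply: (subclosed_compact _ (compact_norm_le (r := 1))).
    apply: (preimage_closed _ (@closed_eq R 1)) => x _.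
    exact: norm_continuous.
  by move=> x /= ->.
have cN : closed (N @` sph).
  apply: compact_closed; first exact: Rhausdorff.
  by apply: continuous_compact => //; apply: continuous_subspaceT; exact: norm_on_continuous.
have N0 : ~ (N @` sph) 0.
  move=> [x /= x1 /norm_on_eq0 x0].
  have /eqP : `|x| == 0 by rewrite normr_eq0; apply/eqP.
  by rewrite x1 => /eqP; rewrite oner_eq0.
have : nbhs (0 : R) (~` (N @` sph)).
  by apply: open_nbhs_nbhs; split=> //; exact: closed_openC.
move=> /nbhs_ballP[c /= c0 cN0]; exists c => // x.
have [->|x0] := eqVneq x 0; first by rewrite normr0 mulr0 norm_on_ge0.
have nx0 : 0 < `|x| by rewrite normr_gt0.
have sx : sph (`|x|^-1 *: x).
  by rewrite /sph/= normrZ normfV normr_id mulVf// gt_eqF.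
have : c <= N (`|x|^-1 *: x).
  rewrite leNgt; apply/negP => Nc.
  have : ball 0 c (N (`|x|^-1 *: x)).
    by rewrite -ball_normE/= sub0r normrN ger0_norm// norm_on_ge0.
  by move/cN0; apply; exists (`|x|^-1 *: x).
by rewrite norm_onZ normfV normr_id ler_pdivlMl// mulrC.
Qed.

Lemma norm_on_sub_continuous (z : V) : continuous (fun x : V => N (x - z) : R).
Proof.
move=> x; apply: (@continuous_comp V V R (fun x => x - z) N x).
  by apply: cvgB; [exact: cvg_id|exact: cvg_cst].
exact: norm_on_continuous.
Qed.

Lemma compact_norm_on_ball (z : V) (r : R) : compact [set x | N (x - z) <= r].
Proof.
have [c c0 cN] := norm_le_norm_on.
have ccl : compact [set x : V | `|x| <= c^-1 * r + `|z|] by exact: compact_norm_le.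
apply: (subclosed_compact _ ccl).
  apply: (preimage_closed _ (@closed_le R r)) => x _.
  exact: norm_on_sub_continuous.
move=> x /= xr; rewrite -[x](subrK z).
apply: (le_trans (ler_normD _ _)); rewrite lerD2r ler_pdivlMl//.
exact: le_trans (cN _) xr.
Qed.

(** Without a finite net, the points of the ball that are [e]-far from a finite set would generate a
    proper filter; at a cluster point [p] its member [far [:: p]] gives a contradiction. *)
Lemma norm_on_ball_net (z : V) (r e : R) : 0 < e -> exists s : seq V,
  forall x, N (x - z) <= r -> exists2 y, y \in s & N (x - y) <= e.
Proof.
move=> e0; apply: contrapT => nonet.
pose far (s : seq V) := [set x | N (x - z) <= r /\ forall y, y \in s -> e < N (x - y)].
pose G : set_system V := [set B | exists s, far s `<=` B].
have GG : ProperFilter G.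
  split; first last.
    split; first by exists [::].
      move=> A B [s sA] [t tB]; exists (s ++ t) => x [xr xst]; split.
        by apply: sA; split=> // y ys; apply: xst; rewrite mem_cat ys.
      by apply: tB; split=> // y yt; apply: xst; rewrite mem_cat yt orbT.
    by move=> A B AB [s sA]; exists s; exact: subset_trans AB.
  move=> [s s0]; apply: nonet; exists s => x xr.
  apply: contrapT => ny; apply: (s0 x); split=> // y ys.
  by rewrite ltNge; apply/negP => xy; apply: ny; exists y.
have [|p [/= pr pG]] := compact_norm_on_ball (z := z) (r := r) GG.
  by exists [::] => x [].
have Gp : G [set x | e < N (x - p)].
  by exists [:: p] => x [_ /(_ p)]; rewrite inE eqxx; exact.
have np : nbhs p [set x | N (x - p) < e].
  apply: open_nbhs_nbhs; split; last by rewrite /= subrr norm_on0.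
  apply: (@open_comp V R (fun x => N (x - p)) [set y | y < e]); last exact: open_lt.
  by move=> x _; exact: norm_on_sub_continuous.
have [x [/= ex xe]] := pG _ _ Gp np.
by have := lt_trans ex xe; rewrite ltxx.
Qed.

End norm_on_product.

Section set_dist_lemmas.
Context (R : realType) (d : nat).
Local Notation V := ('rV[R]_d * R^o)%type.
Variable N : norm_on V.
Implicit Types (A : set V) (z w : V).

Lemma set_dist_has_inf A z : A !=set0 -> has_inf [set N (z - w) | w in A].
Proof.
move=> [w Aw]; split; first by exists (N (z - w)), w.
by exists 0 => _ [y _ <-]; exact: norm_on_ge0.
Qed.

Lemma set_dist_le A z w : A w -> set_dist N z A <= N (z - w).
Proof.
move=> Aw; apply: ge_inf; last by exists w.
by exists 0 => _ [y _ <-]; exact: norm_on_ge0.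
Qed.

Lemma set_dist_ge0 A z : 0 <= set_dist N z A.
Proof.
have [->|/set0P A0] := eqVneq A set0; first by rewrite /set_dist image_set0 inf0.
apply: lb_le_inf; first by have [] := set_dist_has_inf z A0.
by move=> _ [w _ <-]; exact: norm_on_ge0.
Qed.

Lemma set_dist_approx A z e : A !=set0 -> 0 < e ->
  exists2 w, A w & N (z - w) < set_dist N z A + e.
Proof.
by move=> A0 e0; have [_ [w Aw <-] we] := inf_adherent e0 (set_dist_has_inf z A0); exists w.
Qed.

Lemma set_dist_lipschitz A z w : A !=set0 ->
  `|set_dist N z A - set_dist N w A| <= N (z - w).
Proof.
move=> A0.
have half x y : set_dist N x A <= set_dist N y A + N (x - y).
  apply/ler_addgt0Pr => e e0; have [v Av ye] := set_dist_approx y A0 e0.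
  apply: (le_trans (set_dist_le x Av)).
  apply: (le_trans (norm_on_dist_triangle N y _ _)); lra.
have := half z w; have := half w z; rewrite (norm_onB N w z) ler_norml => *.
by apply/andP; split; lra.
Qed.

End set_dist_lemmas.

(** * The integral distance against distance functions on a ball *)

Section aw_dist_bounds.
Context (R : realType) (d : nat) (S : set 'rV[R]_d).
Local Notation V := ('rV[R]_d * R^o)%type.
Variables (N : norm_on V) (zctr : V).
Implicit Types (f g : usc_fcns S) (z w : V).
Local Notation h f z := (set_dist N z (hypo f)).

Lemma hypo_neq0 f : hypo f !=set0.
Proof.
have [x fx] := usc_fun_neqNy f.
case fxE : (f x) fx => [r| |]// _.
  by exists (val x, r); exists x => //=; rewrite fxE.
by exists (val x, 0); exists x => //=; rewrite fxE leey.
Qed.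

Lemma hypo_down f z (a : R) : hypo f z -> a <= z.2 -> hypo f (z.1, a).
Proof.
move=> [x xz zf] az; exists x => //=.
by apply: le_trans zf; rewrite lee_fin.
Qed.

(** Only radii between [M] and [M + 1] are kept; the exponential is smallest at the right end
    point. *)
Lemma aw_dist_ge f g z (M : R) : 0 <= M -> N (z - zctr) <= M ->
  ((`|h f z - h g z| * expR (- (M + 1)))%:E <= aw_dist N zctr f g)%E.
Proof.
move=> M0 zM; rewrite /aw_dist.
set c := _ * _.
have cE : c%:E = (\int[lebesgue_measure]_(rho in `[M, (M + 1)%R]) (cst c%:E) rho)%E.
  rewrite integral_cst//= lebesgue_measure_itv/= lte_fin ifT; last by lra.
  by rewrite -EFinB [X in (_ * X%:E)%E](_ : _ = 1) ?mule1//; lra.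
have sub : `[M, (M + 1)%R]%classic `<=` `[0, +oo[%classic.
  by move=> x /=; rewrite !in_itv/= andbT => /andP[Mx _]; exact: le_trans Mx.
apply: (@le_trans _ _ (\int[lebesgue_measure]_(rho in `[M, (M + 1)%R])
   (aw_dist_rho N zctr rho f g * (expR (- rho))%:E)))%E.
  rewrite cE; apply: ge0_le_integral => //.
  - by move=> x _; rewrite /= lee_fin mulr_ge0// expR_ge0.
  - exact: (measurable_funS _ sub (measurable_aw_integrand N zctr f g)).
  - move=> x; rewrite /= in_itv/= => /andP[Mx xM].
    rewrite /c EFinM; apply: lee_pmul; rewrite ?lee_fin ?expR_ge0//.
      by apply: ereal_sup_ubound; exists z => //=; exact: le_trans zM Mx.
    by rewrite ler_expR; lra.
apply: ge0_subset_integral => //.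
- exact: measurable_aw_integrand.
- exact: aw_integrand_ge0.
Qed.

(** Beyond radius [M] the two 1-Lipschitz functions, being close at [zctr], differ by at most
    [e + 2 * rho]. Half of the exponential decay absorbs [2 * rho], a quarter yields
    [expR (- (M / 4))], and the last quarter remains as the exponential density of rate 1/4, of
    total mass 1. *)
Lemma aw_dist_le f g (M e : R) : 0 <= M -> 0 <= e ->
  (forall z, N (z - zctr) <= M -> `|h f z - h g z| <= e) ->
  (aw_dist N zctr f g <= (4 * e + 16 * expR (- (M / 4)))%:E)%E.
Proof.
move=> M0 e0 close; rewrite /aw_dist.
pose C := e + 4 * expR (- (M / 4)).
have C0 : 0 <= C by rewrite addr_ge0// mulr_ge0// expR_ge0.
have r4 : 0 < 4^-1 :> R by rewrite invr_gt0.
have dle (rho : R) : 0 <= rho ->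
    (aw_dist_rho N zctr rho f g * (expR (- rho))%:E <=
     (4 * C)%:E * (exponential_pdf 4^-1 rho)%:E)%E.
  move=> rho0.
  have dist z : N (z - zctr) <= rho ->
      `|h f z - h g z| <= if rho <= M then e else e + 2 * rho.
    move=> zr; case: (leP rho M) => rM; first by apply: close; exact: le_trans zr rM.
    have c0 : `|h f zctr - h g zctr| <= e.
      by apply: close; rewrite subrr norm_on0.
    have hf := set_dist_lipschitz N z zctr (hypo_neq0 f).
    have hg := set_dist_lipschitz N z zctr (hypo_neq0 g).
    move: c0 hf hg zr; rewrite !ler_norml => /andP[? ?] /andP[? ?] /andP[? ?] ?.
    by apply/andP; split; lra.
  have sup : (aw_dist_rho N zctr rho f g <= (if rho <= M then e else e + 2 * rho)%:E)%E.
    by apply: ge_ereal_sup => _ [z zr <-]; rewrite lee_fin; exact: dist.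
  apply: (le_trans (lee_wpmul2r _ sup)); first by rewrite lee_fin expR_ge0.
  rewrite -!EFinM lee_fin exponential_pdfE//.
  have -> : 4 * C * (4^-1 * expR (- 4^-1 * rho)) = C * expR (- (rho / 4)).
    by rewrite mulNr [4^-1 * rho]mulrC; field.
  have e1 : expR (- rho) <= expR (- (rho / 4)) by rewrite ler_expR; lra.
  case: (leP rho M) => rM.
    by rewrite ler_pM ?expR_ge0// lerDl mulr_ge0// expR_ge0.
  rewrite mulrDl [leRHS]mulrDl lerD//; first by rewrite ler_wpM2l.
  have e2 : 2 * rho <= 4 * expR (rho / 2).
    have := expR_ge1Dx (rho / 2); lra.
  apply: (@le_trans _ _ (4 * expR (rho / 2) * expR (- rho))).
    by rewrite ler_wpM2r// expR_ge0.
  rewrite -!mulrA ler_wpM2l// -!expRD ler_expR; lra.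
apply: (@le_trans _ _ (\int[lebesgue_measure]_(rho in `[0%R, +oo[)
   ((4 * C)%:E * (exponential_pdf 4^-1 rho)%:E))%E).
  apply: ge0_le_integral => //.
  - exact: aw_integrand_ge0.
  - exact: measurable_aw_integrand.
  - apply: emeasurable_funM => //; apply/measurable_EFinP; apply: measurable_funTS.
    exact: measurable_exponential_pdf.
  - by move=> rho; rewrite /= in_itv/= andbT; exact: dle.
have mpdf : measurable_fun setT (fun x => (exponential_pdf (4^-1 : R) x)%:E).
  by apply/measurable_EFinP; exact: measurable_exponential_pdf.
have pdf0 x : (0 <= (exponential_pdf (4^-1 : R) x)%:E)%E.
  by rewrite lee_fin exponential_pdf_ge0// ltW.
rewrite ge0_integralZl//; last 2 first.
- exact: measurable_funTS.
- by rewrite lee_fin mulr_ge0.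
have -> : 4 * e + 16 * expR (- (M / 4)) = 4 * C by rewrite /C; ring.
rewrite -[leRHS]mule1; apply: lee_wpmul2l; first by rewrite lee_fin mulr_ge0.
rewrite -(integral_exponential_pdf r4).
exact: ge0_subset_integral.
Qed.

Lemma aw_dist_small (eta : R) : 0 < eta -> exists M e, [/\ 0 <= M, 0 < e &
  forall f g, (forall z, N (z - zctr) <= M -> `|h f z - h g z| <= e) ->
  (aw_dist N zctr f g < eta%:E)%E].
Proof.
move=> eta0.
have [M M0 Me] : exists2 M, 0 <= M & 16 * expR (- (M / 4)) < eta / 2.
  (* With [t = M / 4 = 32 / eta], the bound [t < expR t] gives
     [16 * expR (- t) < 16 / t = eta / 2]. *)
  exists (4 * (32 / eta)); first by rewrite mulr_ge0// divr_ge0// ltW.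
  have -> : 4 * (32 / eta) / 4 = 32 / eta by field; rewrite gt_eqF.
  have p : 0 < 32 / eta by rewrite divr_gt0.
  have lt1 : 32 / eta < expR (32 / eta).
    have := expR_ge1Dx (32 / eta); lra.
  rewrite expRN -ltr_pdivlMl// invf_plt ?posrE ?expR_gt0//; last by lra.
  by apply: le_lt_trans lt1; rewrite le_eqVlt; apply/orP; left; apply/eqP; field; rewrite gt_eqF.
exists M, (eta / 16); split=> //; first by rewrite divr_gt0.
move=> f g close; apply: le_lt_trans (aw_dist_le M0 _ close) _.
  by rewrite divr_ge0// ltW.
by rewrite lte_fin; lra.
Qed.

Lemma aw_dist_lt_set_dist f g z (M e : R) : 0 <= M -> N (z - zctr) <= M ->
  (aw_dist N zctr f g < (e * expR (- (M + 1)))%:E)%E -> `|h f z - h g z| < e.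
Proof.
move=> M0 zM /(le_lt_trans (aw_dist_ge f g M0 zM)).
by rewrite lte_fin ltr_pM2r// expR_gt0.
Qed.

Lemma aw_dist_fin f g : aw_dist N zctr f g \is a fin_num.
Proof.
rewrite ge0_fin_numE; last by apply: integral_ge0; exact: aw_integrand_ge0.
(* The ball of radius 0 contains only [zctr], so closeness on it holds with the actual difference
   there as [e]. *)
have := @aw_dist_le f g 0 `|h f zctr - h g zctr| (lexx _) (normr_ge0 _).
move=> /(_ _)/le_lt_trans; apply; last exact: ltry.
move=> z z0; have /eqP : N (z - zctr) == 0 by rewrite eq_le z0 norm_on_ge0.
by move/norm_on_eq0/eqP; rewrite subr_eq0 => /eqP ->.
Qed.

End aw_dist_bounds.

(** * Limits of distance functions to hypographs *)

Section aw_limits.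
Context (R : realType) (d : nat) (S : set 'rV[R]_d) (S_closed : closed S).
Local Notation V := ('rV[R]_d * R^o)%type.
Variables (N : norm_on V) (zctr : V).
Local Notation h f z := (set_dist N z (hypo f)).

(** The distance functions lie in a product of segments, compact by Tychonoff. A cluster point for
    pointwise convergence is approached at finitely many points at a time, hence the list [s]. *)
Lemma hypo_dist_cluster (u : nat -> usc_fcns S) (B : R) :
  (forall n, h (u n) zctr <= B) ->
  exists h0 : V -> R, forall (s : seq V) (e : R) m, 0 < e ->
    exists2 n, (m <= n)%N & forall z, z \in s -> `|h (u n) z - h0 z| < e.
Proof.
move=> uB.
have cK := @tychonoff V (fun=> R) (fun z => `[0, B + N (z - zctr)]%classic)
  (fun z => @segment_compact R 0 (B + N (z - zctr))).
have FF : ProperFilter ((fun n z => h (u n) z) @ \oo) by exact: fmap_proper_filter.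
have [] := cK _ FF.
  exists 0%N => // n _ z /=; rewrite in_itv/= set_dist_ge0/=.
  have := set_dist_lipschitz N z zctr (hypo_neq0 (u n)).
  by rewrite ler_norml => /andP[_]; have := uB n; lra.
move=> h0 [_ ch0]; exists h0 => s e m e0.
have [G [GF Gy clG]] : exists G : set_system (V -> R), [/\ Filter G,
    forall y, G [set g | `|g y - h0 y| < e] &
    forall A B, ((fun n z => h (u n) z) @ \oo) A -> G B -> A `&` B !=set0].
  exists (nbhs (h0 : prod_topology (fun=> R))); split=> //.
    exact: (@nbhs_filter (prod_topology (fun=> R))).
  move=> y; apply: (@proj_continuous V (fun=> R) y h0 [set r : R | `|r - h0 y| < e]).
  apply/nbhs_ballP; exists e => //= r.
  by rewrite -ball_normE/= distrC.
have nb : G [set g | forall z, z \in s -> `|g z - h0 z| < e].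
  elim: s => [|y s IH]; first by apply: filterS (@filterT _ G _).
  apply: filterS2 (Gy y) IH => g gy gs z; rewrite inE => /orP[/eqP ->//|].
  exact: gs.
pose late : set (V -> R) := [set g | exists2 n, (m <= n)%N & g = (fun z => h (u n) z)].
have lateP : ((fun n z => h (u n) z) @ \oo) late.
  by exists m => // n /= mn; exists n.
by have [g [[n mn ->] gs]] := clG _ _ lateP nb; exists n.
Qed.

Section limit_function.
Variables (v : nat -> usc_fcns S) (h0 : V -> R).
Hypothesis vh0 : forall k z, N (z - zctr) <= k%:R ->
  `|h (v k) z - h0 z| <= k.+1%:R^-1.

Let vcvg z (e : R) : 0 < e -> \forall k \near \oo, `|h (v k) z - h0 z| < e.
Proof.
move=> e0; near=> k.
apply: (@le_lt_trans _ _ k.+1%:R^-1).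
  by apply: vh0; near: k; exact: nbhs_infty_ger.
by near: k; exact: near_infty_natSinv_lt (PosNum e0).
Unshelve. all: by end_near. Qed.

Let h0_ge0 z : 0 <= h0 z.
Proof.
apply/ler_addgt0Pl => e e0; have [k _ /(_ k (leqnn k))] := vcvg z e0.
by have := set_dist_ge0 N (hypo (v k)) z; rewrite ltr_norml => ? /andP[]; lra.
Qed.

Let h0_lipschitz z w : h0 z <= h0 w + N (z - w).
Proof.
apply/ler_addgt0Pl => e e0; have e2 : 0 < e / 2 by lra.
have [k [kz kw]] := filter_ex (filterI (vcvg z e2) (vcvg w e2)).
have := set_dist_lipschitz N z w (hypo_neq0 (v k)).
move: kz kw; rewrite !ltr_norml ler_norml => /andP[? ?] /andP[? ?] /andP[? ?].
by lra.
Qed.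

(** The zeros of [h0] form the inner limit of the hypographs, through which properties of hypographs
    pass to the limit. *)
Let h0_eq0 z : h0 z = 0 <-> (forall e : R, 0 < e ->
  \forall k \near \oo, exists2 w, hypo (v k) w & N (z - w) < e).
Proof.
split=> [z0 e e0|zP].
  have e2 : 0 < e / 2 by lra.
  have := vcvg z e2; apply: filterS => k; rewrite z0 subr0 ltr_norml => /andP[_ zk].
  have [w hw zw] := set_dist_approx N z (hypo_neq0 (v k)) e2.
  by exists w => //; lra.
apply/eqP; rewrite eq_le h0_ge0 andbT; apply/ler_addgt0Pl => e e0.
have e2 : 0 < e / 2 by lra.
have [k [kz [w hw zw]]] := filter_ex (filterI (vcvg z e2) (zP _ e2)).
have := set_dist_le N z hw; move: kz; rewrite ltr_norml => /andP[? ?] ?.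
by lra.
Qed.

Let h0_S x a : h0 (x, a) = 0 -> S x.
Proof.
move=> /h0_eq0 xa; apply: contrapT => nSx.
have [c c0 cN] := norm_le_norm_on N.
have /nbhs_ballP[r /= r0 rS] : nbhs x (~` S).
  by apply: open_nbhs_nbhs; split=> //; exact: closed_openC.
have [k [w [y yw _] xw]] := filter_ex (xa (c * r) (mulr_gt0 c0 r0)).
apply: (rS (val y)); last by apply: set_mem; exact: (valP y).
rewrite -ball_normE/= -(ltr_pM2l c0); apply: le_lt_trans xw.
apply: le_trans (cN _); rewrite ler_pM2l// yw [leRHS]/Num.norm/= le_max.
by rewrite lexx.
Qed.

Let h0_down x a b : h0 (x, a) = 0 -> b <= a -> h0 (x, b) = 0.
Proof.
move=> /h0_eq0 xa ba; apply/h0_eq0 => e e0.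
apply: filterS (xa e e0) => k [w hw xw].
exists (w.1, w.2 - (a - b)); first by apply: hypo_down hw _; lra.
congr (_ < _) : xw; congr (N _).
by apply/pair_equal_spec; split=> //=; lra.
Qed.

(** Lowering a point by [t] changes [h0] by at most [t * N (0, 1)], and [t] is chosen to keep this
    below [e]. *)
Let h0_left_closed x a : (forall b, b < a -> h0 (x, b) = 0) -> h0 (x, a) = 0.
Proof.
move=> xb; apply/eqP; rewrite eq_le h0_ge0 andbT; apply/ler_addgt0Pl => e e0.
pose t := e / (N (0, 1) + 1).
have N1 : 0 < N (0, 1) + 1 by have := norm_on_ge0 N (0, 1); lra.
have t0 : 0 < t by rewrite divr_gt0.
apply: (le_trans (h0_lipschitz _ (x, a - t))).
rewrite xb; last by lra.
rewrite add0r (_ : _ - _ = t *: (0, 1)); last first.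
  by apply/pair_equal_spec; split=> /=; [rewrite subrr scaler0|rewrite /GRing.scale/= mulr1; lra].
rewrite norm_onZ gtr0_norm// addr0 /t mulrAC ler_pdivrMr// ler_pM2l//; lra.
Qed.

(** Almost nearest points of the hypographs stay bounded, and their cluster points are zeros of
    [h0]. With the Lipschitz bound this makes [h0] the distance to its zero set. *)
Let h0_near z : exists2 w, h0 w = 0 & N (z - w) <= h0 z.
Proof.
have /choice[w wP] : forall k, exists w, hypo (v k) w /\
    N (z - w) < h (v k) z + k.+1%:R^-1.
  move=> k; have k0 : 0 < k.+1%:R^-1 :> R by rewrite invr_gt0.
  by have [w] := set_dist_approx N z (hypo_neq0 (v k)) k0; exists w.
have wcvg (e : R) : 0 < e -> \forall k \near \oo, N (z - w k) < h0 z + e.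
  move=> e0; have e2 : 0 < e / 2 by lra.
  near=> k.
  have : k.+1%:R^-1 < e / 2 by near: k; exact: near_infty_natSinv_lt (PosNum e2).
  have : `|h (v k) z - h0 z| < e / 2 by near: k; exact: vcvg.
  by have [_] := wP k; move: (k.+1%:R^-1) => t; rewrite ltr_norml => ? /andP[? ?] ?; lra.
have [|y [_ yw]] := @compact_norm_on_ball _ _ N z (h0 z + 1) (w @ \oo) _.
  by have := wcvg 1 ltr01; apply: filterS => k; rewrite norm_onB; exact: ltW.
have ynear (e : R) (Q : set nat) : 0 < e -> (\forall k \near \oo, Q k) ->
    exists2 k, Q k & N (w k - y) < e.
  move=> e0 Qo.
  have : (w @ \oo) (w @` Q) by apply: filterS Qo => k Qk; exists k.
  have nb : nbhs y [set x | N (x - y) < e].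
    apply: open_nbhs_nbhs; split; last by rewrite /= subrr norm_on0.
    apply: (@open_comp V R (fun x => N (x - y)) [set t | t < e]); last exact: open_lt.
    by move=> x _; exact: norm_on_sub_continuous.
  by move=> /yw/(_ nb)[_ [[k Qk <-] ke]]; exists k.
exists y.
  apply/eqP; rewrite eq_le h0_ge0 andbT; apply/ler_addgt0Pl => e e0.
  have e2 : 0 < e / 2 by lra.
  have [k ky ke] := ynear _ _ e2 (vcvg y e2).
  have := set_dist_le N y (wP k).1; rewrite norm_onB.
  by move: ky; rewrite ltr_norml => /andP[? ?] ?; lra.
apply/ler_addgt0Pl => e e0; have e2 : 0 < e / 2 by lra.
have [k kz ke] := ynear _ _ e2 (wcvg _ e2).
by apply: (le_trans (norm_on_dist_triangle N (w k) _ _)); lra.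
Unshelve. all: by end_near. Qed.

Lemma usc_limit : exists u : usc_fcns S, forall z, h u z = h0 z.
Proof.
(* The zero set of [h0] is closed downwards and under vertical limits from below, so it is exactly
   the hypograph of the supremum of its levels. *)
pose u (x : S) := ereal_sup [set a%:E | a in [set a : R | h0 (val x, a) = 0]].
have le_u (x : S) (a : R) : (a%:E <= u x)%E <-> h0 (val x, a) = 0.
  split=> [au|xa]; last by apply: ereal_sup_ubound; exists a.
  apply: h0_left_closed => b ba.
  have : (b%:E < u x)%E by apply: lt_le_trans au; rewrite lte_fin.
  by move=> /ereal_sup_gt[_ [a' xa' <-]]; rewrite lte_fin => /ltW; exact: h0_down.
(* If [u x] is below [- a], then [h0] is positive at that height, and by its Lipschitz bound it
   stays positive for all [y] in a ball around [x]. *)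
have u_usc : lower_semicontinuous (fun x => - u x)%E.
  move=> x a; rewrite lteNr -EFinN => ua.
  have ha : 0 < h0 (val x, - a).
    rewrite lt_neqAle h0_ge0 andbT; apply/eqP => /esym /le_u.
    by rewrite leNgt ua.
  have [C C0 NC] := norm_on_le_norm N.
  have r0 : 0 < C^-1 * h0 (val x, - a) by rewrite mulr_gt0// invr_gt0.
  exists (ball x (C^-1 * h0 (val x, - a))); first exact: nbhsx_ballx.
  move=> y xy; rewrite lteNr -EFinN ltNge; apply/negP => /le_u hy.
  have := h0_lipschitz (val x, - a) (val y, - a); rewrite hy add0r.
  apply/negP; rewrite -ltNge; apply: (le_lt_trans (NC _)).
  rewrite -ltr_pdivlMl//.
  have : `|val x - val y| < C^-1 * h0 (val x, - a).
    by move: xy; rewrite -initial_ballE -ball_normE.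
  apply: le_lt_trans; rewrite [leLHS]/Num.norm/= ge_max lexx/=.
  by rewrite subrr normr0.
have u_neqNy : exists x, u x != -oo%E.
  have [[x a] xa _] := h0_near zctr.
  exists (exist _ x (mem_set (h0_S xa))).
  by rewrite -ltNye; apply: lt_le_trans (ltNyr a) _; apply/le_u.
exists (UscFcn u_usc u_neqNy) => z.
have hypoE w : hypo (UscFcn u_usc u_neqNy) w <-> h0 w = 0.
  case: w => x a; split=> [[y /= yx /le_u]|xa]; first by rewrite -yx.
  by exists (exist _ x (mem_set (h0_S xa))) => //=; apply/le_u.
apply/eqP; rewrite eq_le; apply/andP; split.
  have [w /hypoE hw zw] := h0_near z.
  exact: le_trans (set_dist_le N z hw) zw.
apply/ler_addgt0Pl => e e0.
have [w /hypoE w0 zw] := set_dist_approx N z (hypo_neq0 (UscFcn u_usc u_neqNy)) e0.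
by have := h0_lipschitz z w; rewrite w0; lra.
Qed.

End limit_function.

End aw_limits.

Lemma homo_ltn_geq_id (phi : nat -> nat) k :
  {homo phi : i j / (i < j)%N} -> (k <= phi k)%N.
Proof.
move=> phi_lt; elim: k => // k IH.
by apply: leq_ltn_trans IH _; exact: phi_lt.
Qed.

(** * Relative compactness, completeness and separability of the space *)

Section aw_space_topology.
Context (R : realType) (d : nat) (S : set 'rV[R]_d).
Hypotheses (S_neq0 : S !=set0) (S_closed : closed S).
Local Notation V := ('rV[R]_d * R^o)%type.
Variables (N : norm_on V) (zctr : V).
Local Notation U := (aw_space N zctr S_neq0).
Local Notation h f z := (set_dist N z (hypo (f : usc_fcns S))).

(* The distance functions are equi-Lipschitz, so closeness on a finite net of a
   ball propagates to the whole ball. *)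
Lemma lipschitz_net (p q : V -> R) (s : seq V) (M e : R) :
  (forall z w, p z <= p w + N (z - w)) -> (forall z w, q z <= q w + N (z - w)) ->
  (forall z, N (z - zctr) <= M -> exists2 y, y \in s & N (z - y) <= e) ->
  (forall y, y \in s -> `|p y - q y| <= e) ->
  forall z, N (z - zctr) <= M -> `|p z - q z| <= 3 * e.
Proof.
move=> pL qL net pq z /net[y ys zy]; have := pq _ ys; rewrite !ler_norml.
have := pL z y; have := pL y z; have := qL z y; have := qL y z.
rewrite (norm_onB N y z) => ? ? ? ? /andP[? ?].
by apply/andP; split; lra.
Qed.

Lemma hypo_dist_lipschitz (f : usc_fcns S) z w : h f z <= h f w + N (z - w).
Proof.
have := set_dist_lipschitz N z w (hypo_neq0 f).
by rewrite ler_norml => /andP[_]; lra.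
Qed.

(** Closeness to a pointwise cluster point on a finite net gives closeness on the ball of radius [k]
    up to [1 / (k + 1)]; the net has a third of this mesh because [lipschitz_net] triples it. *)
Lemma aw_seq_compact (u : nat -> U) (B : R) : (forall n, h (u n) zctr <= B) ->
  exists phi : nat -> nat, {homo phi : i j / (i < j)%N} /\
    exists l : U, u (phi k) @[k --> \oo] --> l.
Proof.
move=> uB; have [h0 h0P] := hypo_dist_cluster uB.
have h0L z w : h0 z <= h0 w + N (z - w).
  apply/ler_addgt0Pl => e e0; have e2 : 0 < e / 2 by lra.
  have [n _ hn] := h0P [:: z; w] _ 0%N e2.
  have := hn z; have := hn w; rewrite !inE !eqxx orbT => /(_ isT) + /(_ isT).
  have := hypo_dist_lipschitz (u n) z w.
  by rewrite !ltr_norml => ? /andP[? ?] /andP[? ?]; lra.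
have /choice[f fP] : forall km : nat * nat, exists n, (km.2 <= n)%N /\
    forall z, N (z - zctr) <= km.1%:R -> `|h (u n) z - h0 z| <= km.1.+1%:R^-1.
  move=> [k m] /=; have e0 : 0 < k.+1%:R^-1 / 3 :> R.
    by rewrite divr_gt0// invr_gt0.
  have [s net] := norm_on_ball_net N zctr k%:R e0.
  have [n mn hs] := h0P s _ m e0; exists n; split=> // z zk.
  have -> : k.+1%:R^-1 = 3 * (k.+1%:R^-1 / 3) :> R by field.
  apply: (lipschitz_net (hypo_dist_lipschitz (u n)) h0L net _ zk) => y ys.
  exact/ltW/hs.
(* The second argument of [f] is a lower bound for the index it returns, which makes [phi] strictly
   increasing. *)
pose phi := fix phi k := if k is k'.+1 then f (k, (phi k').+1) else f (0, 0)%N.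
have phiS k : (phi k < phi k.+1)%N by have [] := fP (k.+1, (phi k).+1).
exists phi; split; first exact: homo_ltn ltn_trans phiS.
have [|l hl] := usc_limit S_closed (N := N) (zctr := zctr) (v := u \o phi) (h0 := h0).
  by case=> [|k]; [have [_] := fP (0, 0)%N|have [_] := fP (k.+1, (phi k).+1)].
exists (l : U); apply/cvg_ballP => e e0.
have [M [r [M0 r0 small]]] := aw_dist_small S N zctr e0.
near=> k; rewrite /ball/= /aw_ball/=; apply: small => z zM.
rewrite hl distrC; apply: (@le_trans _ _ k.+1%:R^-1).
  have zk : N (z - zctr) <= k%:R.
    by apply: (le_trans zM); near: k; exact: nbhs_infty_ger.
  by case: (k) zk => [|k'] zk; [have [_] := fP (0, 0)%N|have [_] := fP (k'.+1, (phi k').+1)]; exact.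
by apply: ltW; near: k; exact: near_infty_natSinv_lt (PosNum r0).
Unshelve. all: by end_near. Qed.

Lemma ball_hypo_dist (f g : U) (e : R) : ball f (e * expR (- 1)) g ->
  `|h f zctr - h g zctr| < e.
Proof.
rewrite /ball/= /aw_ball/= => fg; apply: (@aw_dist_lt_set_dist _ _ _ N zctr f g zctr 0 e (lexx _)).
  by rewrite subrr norm_on0.
by rewrite add0r.
Qed.

(** The tail of a Cauchy sequence has hypographs at bounded distance from [zctr], hence a convergent
    subsequence, whose limit the whole sequence shares. *)
Lemma aw_space_complete (F : set U) (u : nat -> U) : closed F ->
  (forall n, F (u n)) ->
  (forall e, 0 < e -> exists M, forall m n, (M <= m)%N -> (M <= n)%N ->
    ball (u m) e (u n)) ->
  exists2 l, F l & u n @[n --> \oo] --> l.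
Proof.
move=> cF uF uC.
have e1 : 0 < 1 * expR (- 1) :> R by rewrite mul1r expR_gt0.
have [M MP] := uC _ e1.
have [|phi [phi_lt [l phil]]] := @aw_seq_compact (fun n => u (M + n)%N) (h (u M) zctr + 1).
  move=> n; have := ball_hypo_dist (MP _ _ (leqnn M) (leq_addr n M)).
  by rewrite ltr_norml => /andP[? _]; lra.
have ul : u n @[n --> \oo] --> l.
  apply/cvg_ballP => e e0; have e2 : 0 < e / 2 by lra.
  have [M' M'P] := uC _ e2.
  have /cvg_ballP/(_ _ e2) [K _ KP] := phil.
  exists M' => // n /= Mn; rewrite [e]splitr.
  apply: ball_triangle (KP (maxn K M') (leq_maxl _ _)) _.
  apply: M'P => //; apply: (leq_trans (leq_maxr K M')).
  by apply: leq_trans (leq_addl M _); exact: homo_ltn_geq_id.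
exists l => //; apply: (closed_cvg _ cF _ _ ul).
by apply: nearW.
Qed.

(** A piece collects the functions whose distance functions have the same values on a finite net,
    rounded down to multiples of [e / 3]; there are countably many lists of rounded values. *)
Lemma aw_space_countable_cover : exists K : nat -> nat -> set U,
  (forall k x, exists i, K k i x) /\
  (forall k i x y, K k i x -> K k i y -> ball x k.+1%:R^-1 y).
Proof.
suff /choice[K KP] : forall k : nat, exists K : nat -> set U,
    (forall x, exists i, K i x) /\
    (forall i x y, K i x -> K i y -> ball x k.+1%:R^-1 y).
  by exists K; split=> k; have [] := KP k.
move=> k; have k0 : 0 < k.+1%:R^-1 :> R by rewrite invr_gt0.
have [M [e [M0 e0 small]]] := aw_dist_small S N zctr k0.
have e3 : 0 < e / 3 by lra.
have [s net] := norm_on_ball_net N zctr M e3.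
pose code (x : U) := [seq Num.floor (h x y / (e / 3)) | y <- s].
exists (fun i => [set x | choice.pickle (code x) = i]); split.
  by move=> x; exists (choice.pickle (code x)).
move=> i x y /= <- /(pcan_inj choice.pickleK) xy; apply: small => z zM.
have -> : e = 3 * (e / 3) by field.
apply: (lipschitz_net (hypo_dist_lipschitz x) (hypo_dist_lipschitz y) net _ zM).
move=> w ws /=; have /eq_in_map/(_ w ws) fl := xy.
set a := h x w in fl *; set b := h y w in fl *.
have := floor_itv (a / (e / 3)); have := floor_itv (b / (e / 3)); rewrite fl.
rewrite !intrD !ler_pdivlMr// !ltr_pdivrMr// !mulrDl !mul1r.
move=> /andP[? ?] /andP[? ?]; rewrite -ler_pdivlMr// ler_norml; apply/andP; split; lra.
Qed.

End aw_space_topology.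

(** * Strong law of large numbers *)

Section dyadic_sums.
Context (R : realType).

Let k (c n : nat) : R := c%:R * 2 ^+ n.

(** The nonzero terms double and stay below [y]; carrying the bound [k c N] along closes the
    induction. *)
Lemma dyadic_sum_gt (c : nat) (y : R) N : 0 <= y ->
  \sum_(n < N) (if y <= k c n then 0 else k c n) <= 2 * y.
Proof.
move=> y0.
suff [] : \sum_(n < N) (if y <= k c n then 0 else k c n) <= k c N /\
    \sum_(n < N) (if y <= k c n then 0 else k c n) <= 2 * y by [].
have k0 n : 0 <= k c n by rewrite mulr_ge0 ?exprn_ge0.
have kS n : k c n.+1 = 2 * k c n by rewrite /k exprS; ring.
elim: N => [|N [IH1 IH2]]; first by rewrite big_ord0; split=> //; lra.
rewrite big_ord_recr/= kS; have := k0 N.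
by case: (leP y (k c N)) => yN ?; split; lra.
Qed.

(* Induction on a bound strengthened by the tail of the geometric series. *)
Lemma dyadic_sum_le (c : nat) (y : R) N : (0 < c)%N -> 0 <= y ->
  \sum_(n < N) (if y <= k c n then y ^+ 2 / k c n else 0) <= 2 * y.
Proof.
move=> c0 y0.
have k0 n : 0 < k c n by rewrite mulr_gt0 ?exprn_gt0 ?ltr0n.
have kS n : k c n.+1 = 2 * k c n by rewrite /k exprS; ring.
have sq n : y <= k c n -> y ^+ 2 / k c n <= y.
  by move=> yk; rewrite ler_pdivrMr// expr2 ler_wpM2l.
have sq0 n : 0 <= y ^+ 2 / k c n by rewrite divr_ge0 ?sqr_ge0// ltW.
suff : \sum_(n < N) (if y <= k c n then y ^+ 2 / k c n else 0) <=
    2 * y - (if y <= k c N then 2 * (y ^+ 2 / k c N) else 2 * y).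
  by case: (leP y (k c N)) => _; have := sq0 N; lra.
elim: N => [|N IH].
  rewrite big_ord0; case: (leP y (k c 0%N)) => [/sq|_]; lra.
rewrite big_ord_recr/=.
have half : y ^+ 2 / k c N.+1 = y ^+ 2 / k c N / 2.
  by rewrite kS; field; rewrite gt_eqF.
have kk : k c N < k c N.+1 by rewrite kS; have := k0 N; lra.
move: IH; case: (leP y (k c N)) => yN IH.
  rewrite (le_trans yN (ltW kk)) half; lra.
by case: (leP y (k c N.+1)) => [/sq|_]; lra.
Qed.

(** Every large index lies between [c * 2 ^ n] and [c.+1 * 2 ^ n] with [q <= c < 2 * q]. By
    monotonicity the sums at these two indices enclose the one sought, at a relative cost of
    [1 / q], and only finitely many [c] occur. *)
Lemma dyadic_avg_cvg (S : nat -> R) (m : R) : 0 <= m ->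
  {homo S : i j / (i <= j)%N >-> i <= j} ->
  (forall c (e : R), (0 < c)%N -> 0 < e -> \forall n \near \oo,
    `|S (c * 2 ^ n)%N - k c n * m| <= k c n * e) ->
  n.+1%:R^-1 * S n.+1 @[n --> \oo] --> m.
Proof.
move=> m0 Sle Sd; apply/cvgrPdist_le => /= e e0.
(* The enclosing indices differ by [2 ^ n <= i / q], so passing between them costs at most
   [i * (m / q) <= i * (e / 2)]. *)
have [q q0 qe] : exists2 q, (0 < q)%N & m / q%:R <= e / 2.
  have [n mn] : exists n, 2 * m / e <= n.+1%:R.
    near \oo => n; exists n; rewrite (@le_trans _ _ n%:R)// ?ler_nat//.
    by near: n; exact: nbhs_infty_ger.
  exists n.+1 => //; rewrite ler_pdivrMr// ler_pdivrMr// in mn *; lra.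
have e4 : 0 < e / 4 by lra.
have /choice[M MP] : forall c : nat, exists M, forall n, (M <= n)%N -> (0 < c)%N ->
    `|S (c * 2 ^ n)%N - k c n * m| <= k c n * (e / 4).
  move=> [|c]; first by exists 0%N.
  by have [M _ MP] := Sd c.+1 _ isT e4; exists M => n Mn _; exact: MP.
pose N := (\max_(c < (2 * q).+1) M c)%N.
have NP c n : (0 < c)%N -> (c <= 2 * q)%N -> (N <= n)%N ->
    `|S (c * 2 ^ n)%N - k c n * m| <= k c n * (e / 4).
  move=> c0 cq Nn; apply: MP => //; apply: leq_trans Nn.
  exact: (leq_bigmax (Ordinal (cq : (c < (2 * q).+1)%N))).
exists (q * 2 ^ N)%N => // j /= Nj.
set i := j.+1; have {Nj} Ni : (q * 2 ^ N <= i)%N by exact: leq_trans Nj _.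
have iq : (2 ^ N <= i %/ q)%N by rewrite leq_divRL// mulnC.
have iq0 : (0 < i %/ q)%N by apply: leq_trans iq; rewrite expn_gt0.
(* The largest [n] with [q * 2 ^ n <= i], which forces the quotient of [i] by [2 ^ n] into the range
   from [q] to [2 * q]. *)
set n := trunc_log 2 (i %/ q).
have /andP[n1 n2] := trunc_log_bounds (isT : (1 < 2)%N) iq0.
rewrite -/n in n1 n2.
have Nn : (N <= n)%N by exact: (@trunc_log_max 2 _ _ isT iq).
have p0 : (0 < 2 ^ n)%N by rewrite expn_gt0.
rewrite leq_divRL// mulnC in n1; rewrite ltn_divLR// mulnC expnS mulnA in n2.
set c := (i %/ 2 ^ n)%N.
have qc : (q <= c)%N by rewrite leq_divRL.
have cq : (c < 2 * q)%N by rewrite ltn_divLR// [(2 * q)%N]mulnC.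
have c0 : (0 < c)%N := leq_trans q0 qc.
have ci : (c * 2 ^ n <= i)%N := leq_divM _ _.
have ic : (i <= c.+1 * 2 ^ n)%N by rewrite ltnW// ltn_ceil.
have S1 := NP _ _ c0 (ltnW cq) Nn.
have S2 := NP c.+1 _ isT cq Nn.
have L1 := Sle _ _ ci; have L2 := Sle _ _ ic.
have kc : k c n <= i%:R by rewrite /k -natrX -natrM ler_nat.
have kc1 : k c.+1 n = k c n + 2 ^+ n by rewrite /k -natr1; ring.
have ki : i%:R <= k c.+1 n by rewrite /k -natrX -natrM ler_nat.
have qn : q%:R * 2 ^+ n <= i%:R :> R by rewrite -natrX -natrM ler_nat.
have i0 : 0 < i%:R :> R by rewrite ltr0n.
have t0 : 0 < 2 ^+ n :> R by rewrite exprn_gt0.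
have nm : 2 ^+ n * m <= i%:R * (e / 2).
  have /(ler_wpM2l (ltW t0)) h : m <= (e / 2) * q%:R by rewrite -ler_pdivrMr ?ltr0n.
  apply: (le_trans h).
  have -> : 2 ^+ n * (e / 2 * q%:R) = q%:R * 2 ^+ n * (e / 2) by ring.
  by rewrite ler_wpM2r//; lra.
rewrite distrC -[m](mulKf (lt0r_neq0 i0)) -mulrBr normrM normfV normr_nat.
rewrite ler_pdivrMl// ler_norml.
move: S1 S2; rewrite !ler_norml => /andP[S1 _] /andP[_ S2].
rewrite kc1 in S2 ki.
have tn : 2 ^+ n <= i%:R :> R.
  by apply: le_trans qn; rewrite ler_peMl ?ler1n// ltW.
have ie0 : 0 < i%:R * e by rewrite mulr_gt0.
apply/andP; split.
  have : i%:R * m - 2 ^+ n * m <= k c n * m.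
    by rewrite -mulrBl; apply: ler_wpM2r => //; lra.
  have : k c n * (e / 4) <= i%:R * (e / 4) by apply: ler_wpM2r => //; lra.
  by lra.
have : k c n * m <= i%:R * m by apply: ler_wpM2r.
have : (k c n + 2 ^+ n) * (e / 4) <= (i%:R + i%:R) * (e / 4).
  by apply: ler_wpM2r; lra.
by lra.
Unshelve. all: by end_near. Qed.

End dyadic_sums.

(** * Second moments of iid sums and Chebyshev's inequality *)

Section iid_sums.
Context d d' (Omega : measurableType d) (T : measurableType d') (R : realType).
Context (P : probability Omega R) (X : nat -> {mfun Omega >-> T}).
Hypothesis X_iid : iid P X.
Let P0 : probability T R := distribution P (X 0%N).
Local Open Scope ereal_scope.

Lemma iid_integral j (f : T -> \bar R) : measurable_fun setT f ->
  (forall x, 0 <= f x) -> \int[P]_w f (X j w) = \int[P0]_x f x.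
Proof.
move=> mf f0; rewrite -[LHS](ge0_integral_distribution (X j) mf f0).
by apply: eq_measure_integral => A mA _; have [_ /(_ j A mA)] := X_iid.
Qed.

Lemma iid_measure_preimage j (A : set T) : measurable A -> P (X j @^-1` A) = P0 A.
Proof. by move=> mA; have [_ /(_ j A mA)] := X_iid. Qed.

(** Independence makes the law of the pair agree with the product measure on rectangles, hence
    everywhere; Tonelli then factors the integral. *)
Lemma iid_integral_pair i j (f : T -> \bar R) : i != j ->
  measurable_fun setT f -> (forall x, 0 <= f x) ->
  \int[P]_w (f (X i w) * f (X j w)) = \int[P0]_x f x * \int[P0]_x f x.
Proof.
move=> ij mf f0.
have mXX : measurable_fun setT (fun w => (X i w, X j w)).
  by apply: measurable_fun_pair; exact: measurable_funPT.
pose XX : {mfun Omega >-> (T * T)%type} := mfun_Sub (mem_set mXX).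
have PXX (A : set (T * T)) : measurable A -> (P0 \x P0) A = distribution P XX A.
  apply: product_measure_unique => {}A B mA mB.
  have [ind _] := X_iid.
  have := ind [fset i; j]%fset (fun k => if k == i then A else B).
  rewrite big_fsetU1 ?inE//= big_seq_fset1 eqxx eq_sym (negbTE ij).
  rewrite -(iid_measure_preimage i mA) -(iid_measure_preimage j mB) => <-.
    congr (P _); apply/seteqP; split=> w /=.
      move=> [Aw Bw] k /=; rewrite !inE => /orP[] /eqP ->; rewrite ?eqxx//.
      by rewrite eq_sym (negbTE ij).
    move=> h; split; first by have := h i; rewrite /= !inE !eqxx; exact.
    by have := h j; rewrite /= !inE eqxx orbT eq_sym (negbTE ij); exact.
  by move=> k; case: ifP.
pose ff (z : T * T) := f z.1 * f z.2.
have mff : measurable_fun setT ff.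
  by apply: emeasurable_funM; exact: measurableT_comp.
have ff0 z : 0 <= ff z by exact: mule_ge0.
rewrite -[LHS](ge0_integral_distribution XX mff ff0).
rewrite (eq_measure_integral (P0 \x P0)%E); last by move=> A mA _; exact/esym/PXX.
rewrite (fubini_tonelli1 ff)//= /fubini_F/= /ff/=.
under eq_integral do rewrite ge0_integralZl//.
rewrite ge0_integralZr//; exact: integral_ge0.
Qed.

Lemma iid_sum_deviation (f : T -> R) (m v e : R) n : (0 < n)%N ->
  measurable_fun setT f -> (forall x, (0 <= f x)%R) ->
  \int[P0]_x (f x)%:E = m%:E -> \int[P0]_x (f x ^+ 2)%:E <= v%:E ->
  (0 < e)%R ->
  P [set w | (n%:R * e <= `|\sum_(j < n) f (X j w) - n%:R * m|)%R] <=
    (v / (n%:R * e ^+ 2))%:E.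
Proof.
move=> n0 mf f0 fm fv e0.
have m0 : (0 <= m)%R.
  by rewrite -lee_fin -fm; apply: integral_ge0 => x _; rewrite lee_fin.
have nR0 : (0 < n%:R :> R)%R by rewrite ltr0n.
pose a : R := (n%:R * m)%R.
have a0 : (0 <= a)%R by rewrite mulr_ge0// ltW.
pose S w : R := (\sum_(j < n) f (X j w))%R.
have mfX j : measurable_fun setT (fun w => f (X j w)).
  by apply: (measurableT_comp mf); exact: measurable_funPT.
have mS : measurable_fun setT S by exact: measurable_sum.
have S0 w : (0 <= S w)%R by apply: sumr_ge0.
have IS : \int[P]_w (S w)%:E = a%:E.
  under eq_integral do rewrite -sumEFin.
  rewrite ge0_integral_sum//; last 2 first.
  - by move=> j; exact/measurable_EFinP.
  - by move=> j w _; rewrite lee_fin.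
  under eq_bigr => j _.
    rewrite (iid_integral j (f := EFin \o f)); last 2 first.
    - exact/measurable_EFinP.
    - by move=> x; rewrite lee_fin.
    rewrite fm.
    over.
  by rewrite sumEFin sumr_const card_ord /a mulr_natl.
(* Off-diagonal terms equal [m ^+ 2] by independence and diagonal ones are at most [v]; allowing
   [m ^+ 2] there too makes these squares add up to [a ^+ 2]. *)
have IS2 : \int[P]_w (S w ^+ 2)%:E <= (n%:R * v + a ^+ 2)%:E.
  have -> : \int[P]_w (S w ^+ 2)%:E =
      \sum_(i < n) \sum_(j < n) \int[P]_w (f (X i w) * f (X j w))%:E.
    under eq_integral => w _.
      have -> : (S w ^+ 2 = \sum_(i < n) \sum_(j < n) f (X i w) * f (X j w))%R.
        rewrite expr2 /S mulr_suml; apply: eq_bigr => i _.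
        by rewrite mulr_sumr.
      rewrite -sumEFin.
      over.
    rewrite ge0_integral_sum//; last 2 first.
    - move=> i; apply/measurable_EFinP; apply: measurable_sum => j.
      exact: measurable_funM.
    - by move=> i w _; rewrite lee_fin; apply: sumr_ge0 => j _; rewrite mulr_ge0.
    apply: eq_bigr => i _.
    under eq_integral do rewrite -sumEFin.
    rewrite ge0_integral_sum//.
    - by move=> j; apply/measurable_EFinP; exact: measurable_funM.
    - by move=> j w _; rewrite lee_fin mulr_ge0.
  have term (i j : 'I_n) : \int[P]_w (f (X i w) * f (X j w))%:E <=
      ((if j == i then v else 0) + m ^+ 2)%R%:E.
    case: eqVneq => [->|ji].
      under eq_integral do rewrite -expr2.
      rewrite (iid_integral i (f := fun x => (f x ^+ 2)%:E)).
      - by apply: (le_trans fv); rewrite lee_fin lerDl sqr_ge0.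
      - by apply/measurable_EFinP; exact: measurable_funX.
      - by move=> x; rewrite lee_fin sqr_ge0.
    under eq_integral do rewrite EFinM.
    rewrite (@iid_integral_pair i j (EFin \o f)).
    - by rewrite /= fm -EFinM add0r -expr2.
    - by rewrite eq_sym.
    - exact/measurable_EFinP.
    - by move=> x; rewrite lee_fin.
  apply: (@le_trans _ _ (\sum_(i < n) \sum_(j < n)
      ((if j == i then v else 0) + m ^+ 2)%R%:E)).
    by apply: lee_sum => i _; apply: lee_sum => j _.
  under eq_bigr do rewrite sumEFin big_split/= -big_mkcond/= big_pred1_eq.
  rewrite sumEFin lee_fin sumr_const card_ord sumr_const card_ord /a.
  by rewrite -[leLHS]mulr_natl -[(m ^+ 2 *+ n)%R]mulr_natl le_eqVlt; apply/orP; left; apply/eqP; ring.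
have ISa : \int[P]_w ((S w - a) ^+ 2)%:E <= (n%:R * v)%:E.
  have mSa : measurable_fun setT (fun w => (S w - a)%R) by exact: measurable_funB.
  (* The cross term is kept on the left so that all integrands are nonnegative, and is cancelled
     after integration. *)
  have : \int[P]_w (((S w - a) ^+ 2)%:E + (2 * a * S w)%:E) =
         \int[P]_w ((S w ^+ 2)%:E + (a ^+ 2)%:E).
    by apply: eq_integral => w _; rewrite -!EFinD; congr EFin; ring.
  rewrite ge0_integralD//; last 4 first.
  - by move=> w _; rewrite lee_fin sqr_ge0.
  - by apply/measurable_EFinP; exact: measurable_funX.
  - by move=> w _; rewrite lee_fin !mulr_ge0.
  - by apply/measurable_EFinP; exact: measurable_funM.
  rewrite ge0_integralD//; last 3 first.
  - by move=> w _; rewrite lee_fin sqr_ge0.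
  - by apply/measurable_EFinP; exact: measurable_funX.
  - by move=> w _; rewrite lee_fin sqr_ge0.
  have -> : \int[P]_w (a ^+ 2)%:E = (a ^+ 2)%:E.
    have -> : (fun=> (a ^+ 2)%:E) = cst (a ^+ 2)%:E :> (Omega -> \bar R) by [].
    by rewrite integral_cst//= probability_setT mule1.
  under [X in _ + X]eq_integral do rewrite EFinM.
  rewrite ge0_integralZl//; last 3 first.
  - exact/measurable_EFinP.
  - by move=> w _; rewrite lee_fin.
  - by rewrite lee_fin mulr_ge0.
  rewrite IS => eqI.
  rewrite -(@leeD2rE _ (2 * a * a)%:E)// EFinM eqI.
  apply: (@le_trans _ _ ((n%:R * v + a ^+ 2)%:E + (a ^+ 2)%:E)).
    exact: leeD2r.
  by rewrite -!EFinD lee_fin; lra.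
set A := [set w | _].
have mA : measurable A.
  rewrite -[A]setTI; apply: measurable_fun_le => //.
  apply: measurableT_comp => //; exact: measurable_funB.
have ne0 : (0 < n%:R * e)%R by rewrite mulr_gt0.
have : ((n%:R * e) ^+ 2)%:E * P A <= (n%:R * v)%:E.
  apply: le_trans ISa.
  rewrite -(setIT A) -integral_indic// -ge0_integralZl//; last 2 first.
  - exact/measurable_EFinP.
  - by rewrite lee_fin sqr_ge0.
  apply: ge0_le_integral => //.
  - by move=> w _; rewrite -EFinM lee_fin mulr_ge0 ?sqr_ge0.
  - by apply/measurable_EFinP; apply: measurable_funM.
  - by apply/measurable_EFinP; apply: measurable_funX; exact: measurable_funB.
  - move=> w _; rewrite -EFinM lee_fin indicE.
    have [wA|_] := boolP (w \in A); last by rewrite mulr0 sqr_ge0.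
    rewrite mulr1 -[leRHS]real_normK ?num_real//.
    have : (n%:R * e <= `|S w - a|)%R by exact: (set_mem wA).
    by move=> ?; rewrite lerXn2r ?nnegrE// ltW.
rewrite -(fineK (fin_num_measure P A mA)) -EFinM !lee_fin => h.
rewrite ler_pdivlMr ?mulr_gt0 ?exprn_gt0//.
rewrite -(ler_pM2l nR0); apply: le_trans h.
by rewrite le_eqVlt; apply/orP; left; apply/eqP; ring.
Qed.

End iid_sums.

Section borel_cantelli_ae.
Context d (T : measurableType d) (R : realType) (P : probability T R).
Local Open Scope ereal_scope.

Lemma borel_cantelli_ae (A : nat -> set T) (C : R) :
  (forall n, measurable (A n)) -> (forall M, \sum_(n < M) P (A n) <= C%:E) ->
  {ae P, forall w, \forall n \near \oo, ~ A n w}.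
Proof.
move=> mA AC; exists (lim_sup_set A); split.
- apply: bigcap_measurable => // n _.
  by apply: bigcup_measurable => k _; exact: mA.
- apply: lim_sup_set_cvg0 => //; apply: (@le_lt_trans _ _ C%:E); last exact: ltry.
  apply: lime_le; first exact: is_cvg_nneseries.
  by apply: nearW => M; rewrite big_mkord.
- move=> w /= nAw n _; apply: contrapT => nA; apply: nAw.
  by exists n => // k /= nk Ak; apply: nA; exists k.
Qed.

End borel_cantelli_ae.

Section strong_law.
Context d d' (Omega : measurableType d) (T : measurableType d') (R : realType).
Context (P : probability Omega R) (X : nat -> {mfun Omega >-> T}).
Hypothesis X_iid : iid P X.
Let P0 : probability T R := distribution P (X 0%N).
Local Open Scope ereal_scope.

(* Etemadi's argument: all the terms of the sum of length [k n = c * 2 ^ n] are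
   truncated at the same level [k n], and Chebyshev's inequality is summable. *)
Lemma iid_dyadic_avg (f : T -> R) (m e : R) c : (0 < c)%N ->
  measurable_fun setT f -> (forall x, (0 <= f x)%R) ->
  \int[P0]_x (f x)%:E = m%:E -> (0 < e)%R ->
  {ae P, forall w, \forall n \near \oo,
    (`|\sum_(j < c * 2 ^ n) f (X j w) - c%:R * 2 ^+ n * m| <=
      c%:R * 2 ^+ n * e)%R}.
Proof.
move=> c0 mf f0 fm e0.
pose k n := (c * 2 ^ n)%N; pose kR n : R := (c%:R * 2 ^+ n)%R.
have kE n : (k n)%:R = kR n by rewrite /k /kR natrM natrX.
have k0 n : (0 < k n)%N by rewrite muln_gt0 c0 expn_gt0.
have kR0 n : (0 < kR n)%R by rewrite -kE ltr0n.
pose low n x := (f x <= kR n)%R.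
have mlow n : measurable_fun setT (low n) by exact: measurable_fun_ler.
pose g n x : R := if low n x then f x else 0%R.
have mg n : measurable_fun setT (g n) by exact: measurable_fun_ifT.
have g0 n x : (0 <= g n x)%R by rewrite /g; case: ifP.
have gf n x : (g n x <= f x)%R by rewrite /g; case: ifP.
have gk n x : (g n x <= kR n)%R by rewrite /g /low; case: ifPn => // _; exact: ltW.
have mEf : measurable_fun setT (EFin \o f) by exact/measurable_EFinP.
have ge0_fin (h : T -> R) : measurable_fun setT h -> (forall x, (0 <= h x)%R) ->
    forall C : R, (0 <= C)%R -> (forall x, (h x <= C * f x)%R) ->
    \int[P0]_x (h x)%:E \is a fin_num.
  move=> mh h0 C C0 hC; rewrite ge0_fin_numE; last first.
    by apply: integral_ge0 => x _; rewrite lee_fin.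
  apply: (@le_lt_trans _ _ (\int[P0]_x (C%:E * (f x)%:E))).
    apply: ge0_le_integral => //.
    - by move=> x _; rewrite lee_fin.
    - exact/measurable_EFinP.
    - by apply: emeasurable_funM.
    - by move=> x _; rewrite -EFinM lee_fin.
  rewrite ge0_integralZl//; last by move=> x _; rewrite lee_fin.
  by rewrite fm -EFinM ltry.
pose mn n := fine (\int[P0]_x (g n x)%:E).
have mnE n : \int[P0]_x (g n x)%:E = (mn n)%:E.
  by rewrite fineK// (ge0_fin _ (mg n) (g0 n) 1%R)// => x; rewrite mul1r.
pose v n := fine (\int[P0]_x (g n x ^+ 2)%:E).
have vE n : \int[P0]_x (g n x ^+ 2)%:E = (v n)%:E.
  rewrite fineK// (ge0_fin _ _ _ (kR n))//.
  - exact: measurable_funX.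
  - by move=> x; rewrite sqr_ge0.
  - exact: ltW.
  - by move=> x; rewrite expr2 ler_pM.
have mn_cvg : mn n @[n --> \oo] --> m.
  have : \int[P0]_x (g n x)%:E @[n --> \oo] --> \int[P0]_x limn (fun n => (g n x)%:E).
    apply: cvg_monotone_convergence => //.
    - by move=> n; exact/measurable_EFinP.
    - by move=> n x _; rewrite lee_fin.
    - move=> x _ i j ij; rewrite lee_fin /g /low.
      case: ifPn => [fi|_]; last by case: ifP.
      rewrite ifT//; apply: (le_trans fi).
      by rewrite -!kE ler_nat leq_mul2l leq_exp2l ?ij ?orbT.
  under eq_fun do rewrite mnE.
  have -> : \int[P0]_x limn (fun n => (g n x)%:E) = m%:E.
    rewrite -fm; apply: eq_integral => x _; apply: lim_near_cst => //.
    near=> n; congr EFin; rewrite /g /low ifT//.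
    have : (f x <= n%:R)%R by near: n; exact: nbhs_infty_ger.
    move=> /le_trans; apply; rewrite -kE ler_nat.
    by apply: (leq_trans (ltnW (ltn_expl n (isT : 1 < 2)%N))); rewrite leq_pmull.
  by move=> /fine_cvgP[_].
(* Chebyshev's inequality is used at deviation [e / 2]; the other half is spent on the gap between
   the truncated mean [mn n] and [m]. *)
pose K : R := (((e / 2) ^+ 2)^-1)%R.
have e2 : (0 < e / 2)%R by rewrite divr_gt0.
have K0 : (0 < K)%R by rewrite invr_gt0 exprn_gt0.
pose A n := [set w | ((k n)%:R * (e / 2) <=
  `|\sum_(j < k n) g n (X j w) - (k n)%:R * mn n|)%R].
pose H n := [set x | ~~ low n x].
pose B n := \big[setU/set0]_(j < k n) (X j @^-1` H n).
have mH n : measurable (H n).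
  have := mlow n measurableT [set false] I.
  rewrite setTI (_ : _ @^-1` _ = H n)//.
  by apply/seteqP; split=> x /=; rewrite /H/=; case: (low n x).
have mXj j (C : set T) : measurable C -> measurable (X j @^-1` C).
  by move=> mC; rewrite -[_ @^-1` _]setTI; exact: measurable_funPT.
have mA n : measurable (A n).
  rewrite -[A n]setTI; apply: measurable_fun_le => //.
  apply: measurableT_comp => //; apply: measurable_funB => //.
  apply: measurable_sum => j; apply: (measurableT_comp (mg n)).
  exact: measurable_funPT.
have mB n : measurable (B n) by apply: bigsetU_measurable => j _; exact: mXj.
(* The integral of [K * h1 n] bounds the probability of a deviation of the truncated sum, that of
   [h2 n] the probability that some term is truncated. Summed over [n], each of [h1] and [h2] is at
   most [2 * f] pointwise by the dyadic bounds. *)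
pose h1 n x : R := if low n x then (f x ^+ 2 / kR n)%R else 0%R.
pose h2 n x : R := if low n x then 0%R else kR n.
have mh1 n : measurable_fun setT (h1 n).
  by apply: measurable_fun_ifT => //; apply: measurable_funM => //; exact: measurable_funX.
have mh2 n : measurable_fun setT (h2 n) by exact: measurable_fun_ifT.
have h10 n x : (0 <= h1 n x)%R.
  by rewrite /h1; case: ifP => // _; rewrite divr_ge0 ?sqr_ge0// ltW.
have h20 n x : (0 <= h2 n x)%R by rewrite /h2; case: ifP => // _; exact: ltW.
have PA n : P (A n) <= \int[P0]_x (K * h1 n x)%:E.
  apply: (le_trans (iid_sum_deviation X_iid (k0 n) (mg n) (g0 n) (mnE n) _ e2)).
    by rewrite vE.
  rewrite (_ : (v n / _)%:E = (K / kR n)%:E * (v n)%:E); last first.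
    by rewrite -EFinM; congr EFin; rewrite kE invfM -/K; ring.
  rewrite -vE -ge0_integralZl//.
  - apply: ge0_le_integral => //.
    + by move=> x _; rewrite lee_fin mulr_ge0 ?sqr_ge0// divr_ge0// ltW.
    + by apply: emeasurable_funM => //; apply/measurable_EFinP; exact: measurable_funX.
    + by apply/measurable_EFinP; exact: measurable_funM.
    + move=> x _; rewrite -EFinM lee_fin /h1 /g; case: ifP => _; last first.
        by rewrite expr0n !mulr0.
      by rewrite le_eqVlt; apply/orP; left; apply/eqP; ring.
  - by apply/measurable_EFinP; exact: measurable_funX.
  - by move=> x _; rewrite lee_fin sqr_ge0.
  - by rewrite lee_fin divr_ge0// ltW.
have PB n : P (B n) <= \int[P0]_x (h2 n x)%:E.
  have mXH j : (j < k n)%N -> measurable (X j @^-1` H n) by move=> _; exact: mXj.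
  apply: (le_trans (Boole_inequality P mXH)).
  rewrite (eq_bigr (fun=> P0 (H n))); last first.
    by move=> j _; exact: (iid_measure_preimage X_iid j (mH n)).
  have PH : P0 (H n) = (fine (P0 (H n)))%:E by rewrite fineK// fin_num_measure.
  rewrite PH sumEFin sumr_const card_ord -mulr_natl kE EFinM -PH.
  rewrite -(setIT (H n)) -integral_indic//.
  under [leRHS]eq_integral => x _.
    rewrite (_ : (h2 n x)%:E = (kR n)%:E * (\1_(H n) x)%:E).
      over.
    rewrite -EFinM indicE /h2; case: ifPn => lx.
      by rewrite memNset ?mulr0//= /H/= lx.
    by rewrite mem_set ?mulr1.
  rewrite ge0_integralZl//; last by rewrite lee_fin ltW.
  exact/measurable_EFinP.
have : {ae P, forall w, \forall n \near \oo, ~ (A n `|` B n) w}.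
  apply: (borel_cantelli_ae (C := (K * (2 * m) + 2 * m)%R)).
    by move=> n; exact: measurableU.
  move=> M.
  apply: (@le_trans _ _ (\sum_(n < M) \int[P0]_x (K * h1 n x + h2 n x)%:E)).
    apply: lee_sum => n _.
    apply: (le_trans (measureU2 P (mA n) (mB n))).
    apply: (le_trans (leeD (PA n) (PB n))).
    rewrite -ge0_integralD//.
    - by move=> x _; rewrite lee_fin mulr_ge0// ltW.
    - by apply/measurable_EFinP; exact: measurable_funM.
    - by move=> x _; rewrite lee_fin.
    - exact/measurable_EFinP.
  rewrite -ge0_integral_sum//; last 2 first.
  - move=> n; apply/measurable_EFinP; apply: measurable_funD => //.
    exact: measurable_funM.
  - by move=> n x _; rewrite lee_fin addr_ge0// mulr_ge0// ltW.
  apply: (@le_trans _ _ (\int[P0]_x ((K * 2 + 2)%:E * (f x)%:E))); last first.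
    rewrite ge0_integralZl//.
    - by rewrite fm -EFinM lee_fin; lra.
    - by move=> x _; rewrite lee_fin.
    - by rewrite lee_fin; lra.
  apply: ge0_le_integral => //.
  - move=> x _; apply: sume_ge0 => n _.
    by rewrite lee_fin addr_ge0// mulr_ge0// ltW.
  - apply: emeasurable_sum => n; apply/measurable_EFinP.
    by apply: measurable_funD => //; exact: measurable_funM.
  - exact: emeasurable_funM.
  - move=> x _; rewrite sumEFin -EFinM lee_fin big_split/= -mulr_sumr.
    rewrite mulrDl -mulrA lerD//.
      by rewrite ler_pM2l//; exact: dyadic_sum_le.
    exact: dyadic_sum_gt.
apply: filterS => w nAB.
have : \forall n \near \oo, (`|m - mn n| <= e / 2)%R.
  by move/cvgrPdist_le : mn_cvg; exact.
apply: filterS2 nAB => n nAB mnn.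
have nB j : (j < k n)%N -> low n (X j w).
  move=> jk; apply: contrapT => /negP nl; apply: nAB; right.
  by rewrite /B -(bigcup_mkord _ (fun j => X j @^-1` H n)); exists j => //; exact/negP.
have nA : (`|\sum_(j < k n) g n (X j w) - (k n)%:R * mn n| < (k n)%:R * (e / 2))%R.
  by rewrite ltNge; apply/negP => Aw; apply: nAB; left.
rewrite -/(kR n) -/(k n).
have <- : (\sum_(j < k n) g n (X j w) = \sum_(j < k n) f (X j w))%R.
  by apply: eq_bigr => j _; rewrite /g nB.
rewrite kE in nA.
rewrite (_ : _ - _ = (\sum_(j < k n) g n (X j w) - kR n * mn n) - kR n * (m - mn n))%R; last by ring.
apply: (le_trans (ler_normB _ _)); rewrite normrM (gtr0_norm (kR0 n)).
have : (kR n * `|m - mn n| <= kR n * (e / 2))%R by rewrite ler_pM2l.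
lra.
Unshelve. all: by end_near. Qed.

Lemma slln_ge0 (f : T -> R) (m : R) : measurable_fun setT f ->
  (forall x, (0 <= f x)%R) -> \int[P0]_x (f x)%:E = m%:E ->
  {ae P, forall w,
    (n.+1%:R^-1 * \sum_(j < n.+1) f (X j w))%R @[n --> \oo] --> m}.
Proof.
move=> mf f0 fm.
have m0 : (0 <= m)%R.
  by rewrite -lee_fin -fm; apply: integral_ge0 => x _; rewrite lee_fin.
have : {ae P, forall w, forall c i, \forall n \near \oo,
    (`|\sum_(j < c.+1 * 2 ^ n) f (X j w) - c.+1%:R * 2 ^+ n * m| <=
      c.+1%:R * 2 ^+ n * i.+1%:R^-1)%R}.
  apply: ae_foralln => c; apply: ae_foralln => i.
  by apply: iid_dyadic_avg => //; rewrite invr_gt0.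
apply: filterS => w Hw.
apply: (dyadic_avg_cvg (S := fun n => (\sum_(j < n) f (X j w))%R)) => //.
  move=> i j ij; rewrite -!(big_mkord xpredT (fun j => f (X j w))).
  by rewrite [leRHS](big_cat_nat (n := i))//= lerDl sumr_ge0.
move=> [//|c] e _ e0.
have [i ie] : exists i, (i.+1%:R^-1 <= e)%R.
  near \oo => i; exists i; apply: ltW.
  by near: i; exact: near_infty_natSinv_lt (PosNum e0).
have := Hw c i; apply: filterS => n /le_trans; apply.
by rewrite ler_wpM2l// mulr_ge0// exprn_ge0.
Unshelve. all: by end_near. Qed.

Lemma slln (f : T -> R) : measurable_fun setT f ->
  P0.-integrable setT (EFin \o f) ->
  {ae P, forall w, (n.+1%:R^-1 * \sum_(j < n.+1) f (X j w))%R @[n --> \oo] -->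
    fine (\int[P0]_x (f x)%:E)}.
Proof.
move=> mf fi.
have mp : measurable_fun setT (f^\+)%R by exact: measurable_funrpos.
have mn : measurable_fun setT (f^\-)%R by exact: measurable_funrneg.
have fip : P0.-integrable setT (EFin \o (f^\+)%R).
  by rewrite -funerpos; exact: integrable_funepos.
have fin : P0.-integrable setT (EFin \o (f^\-)%R).
  by rewrite -funerneg; exact: integrable_funeneg.
have pE : \int[P0]_x ((f^\+)%R x)%:E = (fine (\int[P0]_x ((f^\+)%R x)%:E))%:E.
  by rewrite fineK//; exact: integrable_fin_num fip.
have nE : \int[P0]_x ((f^\-)%R x)%:E = (fine (\int[P0]_x ((f^\-)%R x)%:E))%:E.
  by rewrite fineK//; exact: integrable_fin_num fin.
have := slln_ge0 mp (funrpos_ge0 f) pE.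
apply: filterS2 (slln_ge0 mn (funrneg_ge0 f) nE) => w cn cp.
have -> : fine (\int[P0]_x (f x)%:E) =
    (fine (\int[P0]_x ((f^\+)%R x)%:E) - fine (\int[P0]_x ((f^\-)%R x)%:E))%R.
  apply: EFin_inj; rewrite EFinB -pE -nE fineK; last exact: integrable_fin_num fi.
  rewrite integralE; congr (_ - _); apply: eq_integral => x _.
    by rewrite -[LHS]/(((EFin \o f)^\+)%E x) funerpos.
  by rewrite -[LHS]/(((EFin \o f)^\-)%E x) funerneg.
rewrite [X in X @ _](_ : _ =
  (fun n => n.+1%:R^-1 * \sum_(j < n.+1) (f^\+)%R (X j w))%R -
  (fun n => n.+1%:R^-1 * \sum_(j < n.+1) (f^\-)%R (X j w))%R)%R; first exact: cvgB.
apply/funext => n; rewrite !fctE -mulrBr -sumrB; congr (_ * _)%R.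
by apply: eq_bigr => j _; rewrite -[in LHS](funrposBneg f).
Qed.

End strong_law.

(** * The law for extended real-valued functions *)

Section extended_law.
Context d d' (Omega : measurableType d) (T : measurableType d') (R : realType).
Context (P : probability Omega R) (X : nat -> {mfun Omega >-> T}).
Hypothesis X_iid : iid P X.
Let P0 : probability T R := distribution P (X 0%N).
Local Open Scope ereal_scope.

Lemma iid_ae j (Q : T -> Prop) : {ae P0, forall x, Q x} ->
  {ae P, forall w, Q (X j w)}.
Proof.
move=> [B [mB B0 QB]]; exists (X j @^-1` B); split.
- by rewrite -[_ @^-1` _]setTI; exact: measurable_funPT.
- by have := iid_measure_preimage X_iid j mB; rewrite -/P0 B0.
- by move=> w nQ; exact: QB.
Qed.

(** The average in the objective, where dual addition reads [+oo - oo] as [+oo]. *)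
Definition dual_avg n (x : nat -> \bar R) : \bar R :=
  (n.+1%:R^-1)%:E * (\sum_(j < n.+1) x j)%dE.

Lemma dual_avg_le n (x y : nat -> \bar R) :
  (forall j, x j <= y j) -> dual_avg n x <= dual_avg n y.
Proof.
move=> xy; apply: lee_wpmul2l; first by rewrite lee_fin.
by apply: DualAddTheoryRealDomain.lee_dsum => j _.
Qed.

(** An integrable function is almost surely finite along the whole sample, where dual and ordinary
    sums agree. *)
Lemma slln_integrable (f : T -> \bar R) : P0.-integrable setT f ->
  {ae P, forall w, dual_avg n (fun j => f (X j w)) @[n --> \oo] -->
    \int[P0]_x f x}.
Proof.
move=> fi; have mf := measurable_int _ fi.
have fin := integrable_ae measurableT fi.
have fE : ae_eq P0 setT f (EFin \o (fine \o f)).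
  by apply: filterS fin => x fx _ /=; rewrite fineK// fx.
have mff : measurable_fun setT (fine \o f) by exact: measurableT_comp.
have fi' : P0.-integrable setT (EFin \o (fine \o f)).
  apply: (le_integrable measurableT _ _ fi); first exact/measurable_EFinP.
  by move=> x _ /=; case: (f x) => [r| |]//=; rewrite normr0 leey.
have fin' : {ae P, forall w, forall j, f (X j w) \is a fin_num}.
  apply: ae_foralln => j; apply: (@iid_ae j (fun x => f x \is a fin_num)).
  by apply: filterS fin => x; exact.
have IE : \int[P0]_x f x = \int[P0]_x (fine (f x))%:E.
  by apply: ae_eq_integral => //; exact/measurable_EFinP.
have := slln X_iid mff fi'; rewrite -/P0 -IE.
apply: filterS2 fin' => w fw.
rewrite -[in X in _ -> X](fineK (integrable_fin_num measurableT fi)) => cf.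
apply/fine_cvgP; split.
  apply: nearW => n; rewrite /dual_avg.
  by under eq_bigr do rewrite -(fineK (fw _)); rewrite DualAddTheoryNumDomain.dsumEFin -EFinM.
apply: cvg_trans cf; apply: near_eq_cvg; apply: nearW => n /=; rewrite /dual_avg.
by under [in RHS]eq_bigr do rewrite -(fineK (fw _)); rewrite DualAddTheoryNumDomain.dsumEFin.
Qed.

Lemma integral_neg_lty (f : T -> \bar R) :
  -oo < \int[P0]_x f x -> \int[P0]_x f^\- x < +oo.
Proof.
rewrite [\int[P0]_x f x]integralE => h; rewrite ltNge leye_eq; apply/negP => /eqP fy.
by move: h; rewrite fy addeNy ltxx.
Qed.

(** The truncation is dominated by the negative part plus [|m|], so the law applies even when the
    mean of [f] is [+oo]. *)
Lemma integrable_mine_cst (f : T -> \bar R) m : measurable_fun setT f ->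
  \int[P0]_x f^\- x < +oo -> P0.-integrable setT (fun x => mine (f x) m%:E).
Proof.
move=> mf fn.
have fni : P0.-integrable setT f^\-.
  apply/integrableP; split; first exact: measurable_funeneg.
  by under eq_integral do rewrite gee0_abs ?funeneg_ge0//.
have := integrableD measurableT fni
  (finite_measure_integrable_cst P0 `|m|%R measurableT).
apply: (le_integrable measurableT); first exact: measurable_mine.
move=> x _ /=; rewrite [leRHS]gee0_abs ?adde_ge0 ?funeneg_ge0 ?lee_fin//.
rewrite funenegE; case: (f x) => [r| |] /=.
- rewrite -EFin_min/= -EFin_max -EFinD lee_fin.
  have := ler_norm m; have := ler_norm (- m); rewrite normrN => m1 m2.
  have := normr_ge0 m => m3.
  by rewrite ler_norml; case: (leP r m) => ?; case: (leP (- r)%R 0%R) => ?;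
    apply/andP; split; lra.
- by rewrite max_r ?leNye// add0e.
- by rewrite max_l ?leey// addye ?leey.
Qed.

(** Truncating at [m >= 0] leaves the negative part alone, and monotone convergence handles the
    positive part. *)
Lemma integral_mine_cst_gt (f : T -> \bar R) (c : R) : measurable_fun setT f ->
  c%:E < \int[P0]_x f x ->
  exists m : nat, c%:E < \int[P0]_x mine (f x) m%:R%:E.
Proof.
move=> mf cf.
have fn : \int[P0]_x f^\- x < +oo.
  by apply: integral_neg_lty; apply: lt_trans cf; rewrite ltNyr.
have fn_fin : \int[P0]_x f^\- x \is a fin_num.
  by rewrite ge0_fin_numE//; exact: integral_ge0.
have pE m x : (fun x => mine (f x) m%:R%:E)^\+ x = mine (f^\+ x) m%:R%:E.
  rewrite !funeposE; case: (f x) => [r| |] /=.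
  - rewrite -!(EFin_min, EFin_max); congr EFin.
    have := ler0n R m.
    case: (leP r m%:R) => ?; case: (leP r 0%R) => r0 m0.
    - by rewrite min_l.
    - by rewrite min_l.
    - by lra.
    - by rewrite max_l// min_r// ltW.
  - by rewrite max_l ?lee_fin// max_l ?leey// min_r// leey.
  - by rewrite min_l ?leNye// max_r ?leNye// min_l ?lee_fin.
have nE m x : (fun x => mine (f x) m%:R%:E)^\- x = f^\- x.
  rewrite !funenegE; case: (f x) => [r| |] //=.
  - rewrite -!(EFin_min, EFin_max); congr EFin.
    have := ler0n R m; case: (leP r m%:R) => // ? ?.
    by rewrite !max_r//; lra.
  - by rewrite max_r ?lee_fin ?oppr_le0// max_r ?leNye.
  - by rewrite min_l ?leNye.
have IE m : \int[P0]_x mine (f x) m%:R%:E =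
    \int[P0]_x mine (f^\+ x) m%:R%:E - \int[P0]_x f^\- x.
  rewrite integralE; congr (_ - _); apply: eq_integral => x _; first exact: pE.
  exact: nE.
have cvgp : \int[P0]_x mine (f^\+ x) m%:R%:E @[m --> \oo] --> \int[P0]_x f^\+ x.
  have -> : \int[P0]_x f^\+ x = \int[P0]_x limn (fun m : nat => mine (f^\+ x) m%:R%:E).
    apply: eq_integral => x _; apply/esym/cvg_lim => //.
    have := funepos_ge0 f x; case: (f^\+ x) => [r r0| _|//].
      apply: cvg_near_cst; near=> m; rewrite min_l// lee_fin.
      by near: m; exact: nbhs_infty_ger.
    under eq_fun do rewrite min_r ?leey//.
    apply/cvgeyPge => A; near=> m; rewrite lee_fin.
    by near: m; exact: nbhs_infty_ger.
  apply: cvg_monotone_convergence => //.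
  - by move=> m; apply: measurable_mine => //; exact: measurable_funepos.
  - by move=> m x _; rewrite le_min lee_fin ler0n andbT; exact: funepos_ge0.
  - by move=> x _ m n mn; rewrite le_min2// lee_fin ler_nat.
have cp : c%:E + \int[P0]_x f^\- x < \int[P0]_x f^\+ x.
  by move: cf; rewrite integralE lteBrDr.
apply: contrapT => nm; move: cp; apply/negP; rewrite -leNgt -(cvg_lim _ cvgp)//.
apply: lime_le; first exact: cvgP cvgp.
apply: nearW => m; rewrite leNgt; apply/negP => cm; apply: nm; exists m.
by rewrite IE lteBrDr.
Unshelve. all: by end_near. Qed.

End extended_law.

(** * Lower semicontinuous laws and consistency *)

Lemma ereal_rat_between (R : realType) (x y : \bar R) : (x < y)%E ->
  exists q : rat, (x < (ratr q)%:E < y)%E.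
Proof.
move=> xy; have [a [b [ab xa yb]]] : exists a b : R,
    [/\ a < b, (x <= a%:E)%E & (b%:E <= y)%E].
  case: x y xy => [r| |] [s| |] //=; rewrite ?ltxx// => xy.
  - by exists r, s.
  - by exists r, (r + 1); split; rewrite ?leey//; lra.
  - by exists (s - 1), s; split; rewrite ?leNye//; lra.
  - by exists 0, 1; split; rewrite ?leNye ?leey.
have [q] := rat_in_itvoo ab; rewrite in_itv/= => /andP[aq qb]; exists q.
by rewrite (le_lt_trans xa)//= (lt_le_trans _ yb).
Qed.

Lemma abse_mine_le (R : realType) (a b : \bar R) (m : R) : 0 <= m ->
  (a <= b -> `|mine b m%:E| <= maxe (- a) 0 + m%:E)%E.
Proof.
move=> m0; case: a => [r| |]; case: b => [s| |] //= ab.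
- rewrite -EFin_min/= -EFin_max -EFinD lee_fin ler_norml; move: ab; rewrite lee_fin.
  case: (leP s m) => ? ?; case: (leP (- r)%R 0%R) => ?; apply/andP; split; lra.
- by rewrite ger0_norm// leeDr// le_max lexx orbT.
- by rewrite ger0_norm// leeDr// le_max lexx orbT.
- by rewrite max_l ?leey// addye// leey.
- by rewrite max_l ?leey// addye// leey.
- by rewrite max_l ?leey// addye// leey.
Qed.

Section lsc_law.
Context (R : realType) (d : nat) (S : set 'rV[R]_d).
Hypotheses (S_neq0 : S !=set0) (S_closed : closed S).
Variables (N : norm_on ('rV[R]_d * R^o)%type) (zctr : 'rV[R]_d * R^o).
Local Notation U := (aw_space N zctr S_neq0).
Local Notation dist := (aw_dist N zctr).
Context dO dT (Omega : measurableType dO) (T : measurableType dT).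
Context (P : probability Omega R) (X : nat -> {mfun Omega >-> T}).
Hypothesis X_iid : iid P X.
Let P0 : probability T R := distribution P (X 0%N).
Hypothesis P0_complete : measure_is_complete P0.
Variables (F : set U) (psi : T -> U -> \bar R).
Hypotheses (F_closed : closed F) (psi_lsc : random_lsc F psi).
Hypothesis psi_int : locally_inf_integrable P0 F psi.
Local Open Scope ereal_scope.

Lemma closed_aw_ball (f : U) (r : R) : closed [set g : U | dist f g <= r%:E].
Proof.
rewrite -openC openE => g /= /negP; rewrite -ltNge => rfg.
have fgfin := aw_dist_fin N zctr f g.
apply/nbhs_ballP; exists (fine (dist f g) - r)%R => /=.
  by rewrite subr_gt0 -lte_fin fineK.
move=> k; rewrite /ball/= /aw_ball/= => gk fk.
have := aw_dist_triangle N zctr k f g; rewrite (aw_dist_sym N zctr k g).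
apply/negP; rewrite -ltNge -(fineK fgfin) -(subrKC r (fine _)) EFinD.
exact: (lee_ltD (aw_dist_fin N zctr f k) fk gk).
Qed.

Lemma measurable_closed (C : set U) : closed C ->
  measurable (C : set (g_sigma_algebraType (@open U))).
Proof.
move=> cC; rewrite -[C]setCK; apply: measurableC; apply: sub_sigma_algebra.
exact: closed_openC.
Qed.

Let mD (Y : set (\bar R)) : measurable Y ->
  measurable [set xf : T * g_sigma_algebraType (@open U) | F xf.2 /\ Y (psi xf.1 xf.2)].
Proof.
move=> mY; have [_ mpsi] := psi_lsc.
have := mpsi (measurableX measurableT (measurable_closed F_closed)) Y mY.
by congr measurable; apply/seteqP; split=> [z [[_ Fz] Yz]|z [Fz Yz]].
Qed.

Lemma measurable_psi f : F f -> measurable_fun setT (psi^~ f).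
Proof.
move=> Ff _ Y mY; rewrite setTI.
have := @measurable_ysection _ _ T (g_sigma_algebraType (@open U)) _ f (mD mY); congr measurable.
apply/seteqP; split=> x; rewrite /ysection /= inE/=; first by case.
by [].
Qed.

Definition inf_ball (f : U) (r : R) (x : T) : \bar R :=
  ereal_inf [set psi x g | g in F `&` [set g | dist f g <= r%:E]].

(** An infimum is strictly below [a] exactly when some value is, so strict sublevel sets are
    projections. *)
Lemma measurable_inf_ball f r : measurable_fun setT (inf_ball f r).
Proof.
apply: (measurability _ (ErealGenInftyO.measurableE R)) => //.
move=> _ [_ [a ->] <-]; rewrite setTI.
have [K [Kcov Ksmall]] := aw_space_countable_cover S_neq0 N zctr.
pose A : set (T * g_sigma_algebraType (@open U)) :=
  [set xf | F xf.2 /\ `]-oo, a%:E[%classic (psi xf.1 xf.2)] `&`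
  setT `*` [set g | dist f g <= r%:E].
have mA : measurable A.
  apply: measurableI; first by apply: mD; exact: emeasurable_itv.
  by apply: measurableX => //; apply: measurable_closed; exact: closed_aw_ball.
have := measurable_projection P0_complete
  (fun u => @aw_space_complete _ _ _ S_neq0 S_closed N zctr F u F_closed)
  (fun k x _ => Kcov k x) Ksmall mA.
congr measurable; apply/seteqP; split=> x /=; rewrite in_itv/=.
  move=> [g Fg [[_ /=]]]; rewrite in_itv/= => xg [_ fg].
  by apply: le_lt_trans xg; apply: ereal_inf_lbound; exists g.
move=> /ereal_inf_lt[_ [g [Fg fg] <-] xg].
by exists g => //; split => //; split => //=; rewrite in_itv.
Qed.

Lemma inf_ball_le f r x g : F g -> dist f g <= r%:E -> inf_ball f r x <= psi x g.
Proof. by move=> Fg fg; apply: ereal_inf_lbound; exists g. Qed.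

Lemma inf_ball_subset f r f' r' x :
  (forall g, dist f' g <= r'%:E -> dist f g <= r%:E) ->
  inf_ball f r x <= inf_ball f' r' x.
Proof.
move=> sub; apply: le_ereal_inf_tmp => _ [g [Fg fg] <-].
by apply: ereal_inf_lbound; exists g => //; split=> //; exact: sub.
Qed.

Lemma inf_ball_nonincreasing f r r' x : (r' <= r)%R ->
  inf_ball f r x <= inf_ball f r' x.
Proof.
move=> rr; apply: inf_ball_subset => g; move=> /le_trans; apply.
by rewrite lee_fin.
Qed.

(** Otherwise points tending to [f] would have values below some [q < psi x f], against lower
    semicontinuity. *)
Lemma inf_ball_cvg f x : F f ->
  inf_ball f k.+1%:R^-1 x @[k --> \oo] --> psi x f.
Proof.
move=> Ff; have [/(_ x) lsc _] := psi_lsc.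
have inc : nondecreasing_seq (fun k => inf_ball f k.+1%:R^-1 x).
  move=> i j ij; apply: inf_ball_nonincreasing.
  by rewrite lef_pV2 ?posrE// ler_nat.
have cv := ereal_nondecreasing_cvgn inc.
suff : psi x f <= ereal_sup (range (fun k => inf_ball f k.+1%:R^-1 x)).
  move=> le; rewrite [psi x f](_ : _ = ereal_sup (range (fun k => inf_ball f k.+1%:R^-1 x)))//.
  apply/eqP; rewrite eq_le le/=; apply: ge_ereal_sup => _ [k _ <-].
  by apply: inf_ball_le => //; rewrite aw_distxx lee_fin.
rewrite leNgt; apply/negP => lt.
have [q0 /andP[]] := ereal_rat_between lt; set q := ratr q0 => q1 q2.
have /choice[g gP] : forall k, exists g : U,
    [/\ F g, dist f g <= (k.+1%:R^-1)%:E & psi x g < q%:E].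
  move=> k; have : inf_ball f k.+1%:R^-1 x < q%:E.
    by apply: le_lt_trans q1; apply: ereal_sup_ubound; exists k.
  by move=> /ereal_inf_lt[_ [g [Fg fg] <-] xg]; exists g.
have gf : g k @[k --> \oo] --> f.
  apply/cvg_ballP => e e0; near=> k; rewrite /ball/= /aw_ball/=.
  have [_ + _] := gP k; move/le_lt_trans; apply; rewrite lte_fin.
  by near: k; exact: near_infty_natSinv_lt (PosNum e0).
have Fg k : F (g k) by have [] := gP k.
have := lsc _ _ Fg Ff gf; apply/negP; rewrite -ltNge.
apply: le_lt_trans q2; rewrite limn_einf_lim; apply: lime_le; first exact: is_cvg_einfs.
apply: nearW => k; apply: ereal_inf_le; exists (psi x (g k)); first by exists k => /=.
by apply: ltW; have [] := gP k.
Unshelve. all: by end_near. Qed.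

Lemma inf_ball_neg_lty f : F f -> exists2 rho : R, (0 < rho)%R &
  \int[P0]_x (inf_ball f rho)^\- x < +oo.
Proof.
move=> Ff; have [rho rho0 h] := psi_int Ff; exists rho => //.
exact: (integral_neg_lty h).
Qed.

Lemma le_integral_neg (g h : T -> \bar R) :
  measurable_fun setT g -> measurable_fun setT h -> (forall x, g x <= h x) ->
  \int[P0]_x h^\- x <= \int[P0]_x g^\- x.
Proof.
move=> mg mh gh; apply: ge0_le_integral => //.
- exact: measurable_funeneg.
- exact: measurable_funeneg.
- by move=> x _; rewrite !funenegE le_max2// leeN2.
Qed.

Lemma psi_neg_lty f : F f -> \int[P0]_x (psi^~ f)^\- x < +oo.
Proof.
move=> Ff; have [rho rho0] := inf_ball_neg_lty Ff; apply: le_lt_trans.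
apply: le_integral_neg; [exact: measurable_inf_ball|exact: measurable_psi|].
by move=> x; apply: inf_ball_le => //; rewrite aw_distxx lee_fin ltW.
Qed.

(** The negative part has finite integral, so both conventions for [+oo - oo] give the same mean. *)
Lemma ext_integral_psi f : F f ->
  ext_integral P (fun w => psi (X 0%N w) f) = \int[P0]_x psi x f.
Proof.
move=> Ff; have mpsi := measurable_psi Ff.
have pE : \int[P]_w (fun w => psi (X 0%N w) f)^\+ w = \int[P0]_x (psi^~ f)^\+ x.
  rewrite -(iid_integral X_iid 0%N (measurable_funepos mpsi) (funepos_ge0 _)).
  by apply: eq_integral => w _; rewrite !funeposE.
have nE : \int[P]_w (fun w => psi (X 0%N w) f)^\- w = \int[P0]_x (psi^~ f)^\- x.
  rewrite -(iid_integral X_iid 0%N (measurable_funeneg mpsi) (funeneg_ge0 _)).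
  by apply: eq_integral => w _; rewrite !funenegE.
rewrite /ext_integral pE nE [RHS]integralE.
have := psi_neg_lty Ff.
have : 0 <= \int[P0]_x (psi^~ f)^\- x by exact: integral_ge0.
have : 0 <= \int[P0]_x (psi^~ f)^\+ x by exact: integral_ge0.
by case: (\int[P0]_x (psi^~ f)^\+ x) => [a| |] //; case: (\int[P0]_x (psi^~ f)^\- x).
Qed.

(** A mean below [c] bounds the positive part too, so [psi(., g)] is integrable. *)
Lemma psi_upper_law g (c : R) : F g -> \int[P0]_x psi x g < c%:E ->
  {ae P, forall w, \forall n \near \oo, dual_avg n (fun j => psi (X j w) g) < c%:E}.
Proof.
move=> Fg gc; have mpsi := measurable_psi Fg.
have nlty := psi_neg_lty Fg.
have plty : \int[P0]_x (psi^~ g)^\+ x < +oo.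
  rewrite ltNge leye_eq; apply/negP => /eqP py.
  move: gc; rewrite integralE py.
  have : 0 <= \int[P0]_x (psi^~ g)^\- x by exact: integral_ge0.
  by move: nlty; case: (\int[P0]_x (psi^~ g)^\- x).
have ig : P0.-integrable setT (psi^~ g).
  apply/integrableP; split => //.
  under eq_integral do rewrite -/((abse \o psi^~ g) _) fune_abse.
  rewrite ge0_integralD//; first exact: lte_add_pinfty.
  - exact: measurable_funepos.
  - exact: measurable_funeneg.
apply: filterS (slln_integrable X_iid ig) => w cw.
exact: (cw _ (open_ereal_lt' gc)).
Qed.

(* Locally around [f] the infimum of [psi x] stays, in the mean, above any
   [c < E f]; countably many such infima suffice because the space is separable. *)
Lemma psi_lower_law : {ae P, forall w, forall f (c : R), F f ->
  c%:E < \int[P0]_x psi x f -> exists2 r : R, (0 < r)%R &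
  \forall n \near \oo, forall g, F g -> dist f g <= r%:E ->
    c%:E < dual_avg n (fun j => psi (X j w) g)}.
Proof.
have [K [Kcov Ksmall]] := aw_space_countable_cover S_neq0 N zctr.
have /choice[ctr0 ctr0P] : forall ki : nat * nat, exists f : U,
    forall f', K ki.1 ki.2 f' -> K ki.1 ki.2 f.
  move=> [k i] /=; have [[f Kf]|nK] := pselect (exists f, K k i f).
    by exists f.
  by exists point => f Kf; exfalso; apply: nK; exists f.
pose ctr k i := ctr0 (k, i).
have ctrP k i f : K k i f -> dist (ctr k i) f < (k.+1%:R^-1)%:E.
  by move=> Kf; exact: (Ksmall k i _ _ (ctr0P (k, i) f Kf) Kf).
pose q k i (m : nat) x := mine (inf_ball (ctr k i) (2 / k.+1%:R)%R x) m%:R%:E.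
have : {ae P, forall w, forall k i m, P0.-integrable setT (q k i m) ->
    dual_avg n (fun j => q k i m (X j w)) @[n --> \oo] --> \int[P0]_x q k i m x}.
  apply: ae_foralln => k; apply: ae_foralln => i; apply: ae_foralln => m.
  have [iq|niq] := pselect (P0.-integrable setT (q k i m)).
    by apply: filterS (slln_integrable X_iid iq) => w.
  by apply: aeW => w /niq.
apply: filterS => w qw f c Ff cf.
have [m cm] := integral_mine_cst_gt (measurable_psi Ff) cf.
have [rho rho0 rholty] := inf_ball_neg_lty Ff.
have [k0 k0rho] : exists k0 : nat, (k0.+1%:R^-1 <= rho)%R.
  near \oo => k0; exists k0; apply: ltW.
  by near: k0; exact: near_infty_natSinv_lt (PosNum rho0).
pose p k x := mine (inf_ball f k.+1%:R^-1 x) m%:R%:E.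
have mib := measurable_inf_ball.
have mp k : measurable_fun setT (p k) by apply: measurable_mine.
have [k1 k1k0 ck1] : exists2 k1, (k0 <= k1)%N & c%:E < \int[P0]_x p k1 x.
  (* Domination holds for radii at most [rho], hence the shift of the indices by [k0]. *)
  pose dom x := (inf_ball f rho)^\- x + m%:R%:E.
  have dle k x : `|p (k0 + k)%N x| <= dom x.
    rewrite /p /dom funenegE; apply: abse_mine_le => //.
    apply: inf_ball_nonincreasing; apply: le_trans k0rho.
    by rewrite lef_pV2 ?posrE// ler_nat ltnS leq_addr.
  have idom : P0.-integrable setT dom.
    apply: integrableD => //; last exact: finite_measure_integrable_cst.
    apply/integrableP; split; first exact: measurable_funeneg.
    by under eq_integral do rewrite gee0_abs ?funeneg_ge0//.
  have pcvg x : p (k0 + k)%N x @[k --> \oo] --> mine (psi x f) m%:R%:E.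
    have nd : nondecreasing_seq (fun k => p (k0 + k)%N x).
      move=> a b ab; apply: le_min2 => //; apply: inf_ball_nonincreasing.
      by rewrite lef_pV2 ?posrE// ler_nat ltnS leq_add2l.
    have := ereal_nondecreasing_cvgn nd; congr (_ --> _).
    apply/eqP; rewrite eq_le; apply/andP; split.
      apply: ge_ereal_sup => _ [k _ <-]; apply: le_min2 => //.
      by apply: inf_ball_le => //; rewrite aw_distxx lee_fin.
    rewrite leNgt; apply/negP => /ereal_rat_between[y /andP[sy]].
    rewrite lt_min => /andP[yf ym].
    have : \forall k \near \oo, (ratr y)%:E < inf_ball f k.+1%:R^-1 x.
      exact: (inf_ball_cvg Ff (open_ereal_gt' yf)).
    move=> [k _ yk]; move: sy; rewrite ltNge => /negP; apply.
    apply: (@le_trans _ _ (p (k0 + k)%N x)).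
      by rewrite le_min (ltW ym) andbT; apply/ltW/yk; exact: leq_addl.
    by apply: ereal_sup_ubound; exists k.
  have [_ _ cI] := dominated_convergence (mu := P0) measurableT
    (fun k => mp (k0 + k)%N) (measurable_mine (measurable_psi Ff) (measurable_cst _))
    (aeW P0 (fun x _ => pcvg x)) idom (aeW P0 (fun x k _ => dle k x)).
  have /filter_ex[k ck] : \forall k \near \oo, c%:E < \int[P0]_x p (k0 + k)%N x.
    exact: (cI _ (open_ereal_gt' cm)).
  by exists (k0 + k)%N => //; exact: leq_addr.
(* The ball of radius [2 / (k + 1)] around a center within [1 / (k + 1)] of [f] contains the ball of
   radius [1 / (k + 1)] around [f] and lies in that of radius [3 / (k + 1)], which is at most
   [1 / (k1 + 1)]. *)
pose k := (3 * k1.+1)%N.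
have k3 : (3 / k.+1%:R <= k1.+1%:R^-1 :> R)%R.
  rewrite ler_pdivrMr// mulrC ler_pdivlMr// -natrM ler_nat.
  by rewrite /k ltnW.
have [i Ki] := Kcov k f; have cf1 := ctrP _ _ _ Ki.
have ballsub g : dist (ctr k i) g <= (2 / k.+1%:R)%R%:E -> dist f g <= (k1.+1%:R^-1)%:E.
  move=> cg; apply: le_trans (aw_dist_triangle N zctr (ctr k i) f g) _.
  rewrite aw_dist_sym; apply: (le_trans (leeD (ltW cf1) cg)).
  by rewrite -EFinD lee_fin; apply: le_trans k3; move: (k.+1%:R^-1)%R => a; lra.
have pq x : p k1 x <= q k i m x.
  by apply: le_min2 => //; exact: inf_ball_subset ballsub.
have infle x : inf_ball f rho x <= inf_ball (ctr k i) (2 / k.+1%:R)%R x.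
  apply: inf_ball_subset => g /ballsub/le_trans; apply; rewrite lee_fin.
  by apply: le_trans k0rho; rewrite lef_pV2 ?posrE// ler_nat.
have iq : P0.-integrable setT (q k i m).
  apply: integrable_mine_cst => //; apply: le_lt_trans rholty.
  exact: le_integral_neg.
have ip : P0.-integrable setT (p k1).
  apply: integrable_mine_cst => //; apply: le_lt_trans rholty.
  apply: le_integral_neg => // x; apply: inf_ball_nonincreasing.
  by apply: le_trans k0rho; rewrite lef_pV2 ?posrE// ler_nat.
have cq : c%:E < \int[P0]_x q k i m x.
  by apply: (lt_le_trans ck1); apply: le_integral => // x _; exact: pq.
exists (k.+1%:R^-1)%R; first by rewrite invr_gt0.
have : \forall n \near \oo, c%:E < dual_avg n (fun j => q k i m (X j w)).
  exact: (qw k i m iq _ (open_ereal_gt' cq)).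
apply: filterS => n /lt_le_trans cn g Fg fg; apply: cn; apply: dual_avg_le => j.
apply: (@le_trans _ _ (inf_ball (ctr k i) (2 / k.+1%:R)%R (X j w))).
  by rewrite /q ge_min lexx.
apply: inf_ball_le => //.
apply: le_trans (aw_dist_triangle N zctr f (ctr k i) g) _.
apply: (le_trans (leeD (ltW cf1) fg)).
by rewrite -EFinD lee_fin; move: (k.+1%:R^-1)%R => a; lra.
Unshelve. all: by end_near. Qed.

End lsc_law.

(** * Limits of the thickened constraint sets *)

Section thickening.
Context (R : realType) (d : nat) (S : set 'rV[R]_d).
Hypotheses (S_neq0 : S !=set0) (S_closed : closed S).
Variables (N : norm_on ('rV[R]_d * R^o)%type) (zctr : 'rV[R]_d * R^o).
Local Notation U := (aw_space N zctr S_neq0).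
Local Notation dist := (aw_dist N zctr).
Variables (F : set U) (Fn : nat -> set U) (LimF : set U) (delta : R).
Hypotheses (F_closed : closed F) (Fn_sub : forall n, Fn n `<=` F).
Hypotheses (LimFP : set_converges Fn LimF) (delta_gt0 : 0 < delta).

Lemma set_limit_sub : LimF `<=` F.
Proof.
have [_ <-] := LimFP; move=> f [a [Fa af]].
apply: (closed_cvg _ F_closed _ _ af).
by apply: filterS Fa => n; exact: Fn_sub.
Qed.

Lemma near_aw_dist (u : nat -> U) (l : U) (e : R) : u n @[n --> \oo] --> l ->
  0 < e -> \forall n \near \oo, (dist l (u n) < e%:E)%E.
Proof. by move=> /cvg_ballP/(_ e) ul /ul. Qed.

Lemma set_limit_thicken g : LimF g ->
  \forall n \near \oo, aw_thicken F delta (Fn n) g.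
Proof.
move=> Lg; have Fg := set_limit_sub Lg.
move: Lg; have [_ <-] := LimFP => -[b [Fb bg]].
apply: filterS2 Fb (near_aw_dist bg delta_gt0) => n Fb bgn; split=> //.
by apply: (le_trans _ (ltW bgn)); apply: ereal_inf_lbound; exists (b n).
Qed.

(* Near-minimizers of the distance stay in a bounded, hence relatively compact,
   part of the space, and their cluster points lie in the outer limit. *)
Lemma thicken_limit (phi : nat -> nat) (a : nat -> U) f :
  {homo phi : i j / (i < j)%N} -> (forall k, aw_thicken F delta (Fn (phi k)) (a k)) ->
  a k @[k --> \oo] --> f -> aw_thicken F delta LimF f.
Proof.
move=> phi_lt aT af; split.
  apply: (closed_cvg _ F_closed _ _ af).
  by apply: nearW => k; case: (aT k).
have /choice[g gP] : forall k, exists g, Fn (phi k) g /\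
    (dist (a k) g < (delta + k.+1%:R^-1)%:E)%E.
  move=> k; have [_ ak] := aT k.
  have : (ereal_inf [set dist (a k) g | g in Fn (phi k)] < (delta + k.+1%:R^-1)%:E)%E.
    by apply: (le_lt_trans ak); rewrite lte_fin ltrDl invr_gt0.
  by move=> /ereal_inf_lt[_ [g Fg <-] ag]; exists g.
have [K _ KP] := near_aw_dist af ltr01.
have inv1 (k : nat) : k.+1%:R^-1 <= 1 :> R.
  by rewrite invf_le1 ?ltr0n// ler1n.
have fg k : (dist f (g (K + k)%N) < (delta + 2)%:E)%E.
  apply: (le_lt_trans (aw_dist_triangle N zctr (a (K + k)%N) _ _)).
  have [_ ag] := gP (K + k)%N.
  apply: (lt_le_trans (lteD (KP _ (leq_addr k K)) ag)).
  by rewrite -EFinD lee_fin; have := inv1 (K + k)%N; move: (_^-1) => x; lra.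
(* The factor [expR 1] undoes the [expR (- 1)] that bounds distances at [zctr] by the distance of
   the functions. *)
have [|psi [psi_lt [l gl]]] := @aw_seq_compact _ _ _ S_neq0 S_closed N zctr
    (fun k => g (K + k)%N) (set_dist N zctr (hypo (f : usc_fcns S)) + (delta + 2) * expR 1).
  move=> k; have := @ball_hypo_dist _ _ _ S_neq0 N zctr f (g (K + k)%N) ((delta + 2) * expR 1).
  rewrite -mulrA -expRD subrr expR0 mulr1 => /(_ (fg k)).
  by rewrite ltr_norml => /andP[? _]; lra.
have Ll : LimF l.
  have [<- _] := LimFP; exists (fun k => phi (K + psi k)%N), (fun k => g (K + psi k)%N).
  split=> //; last by move=> k; have [] := gP (K + psi k)%N.
  by move=> i j /psi_lt ij; apply: phi_lt; rewrite ltn_add2l.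
apply: (@le_trans _ _ (dist f l)); first by apply: ereal_inf_lbound; exists l.
apply/lee_addgt0Pr => e e0; have e3 : 0 < e / 3 by lra.
have : \forall k \near \oo, (dist f l < (delta + e)%:E)%E.
  have [M _ MP] := near_aw_dist af e3.
  near=> k.
  have jk : (k <= K + psi k)%N by apply: leq_trans (leq_addl _ _); exact: homo_ltn_geq_id.
  have d1 : (dist f (a (K + psi k)%N) < (e / 3)%:E)%E.
    by apply: MP; apply: leq_trans jk; near: k; exact: nbhs_infty_ge.
  have d2 : (dist l (g (K + psi k)%N) < (e / 3)%:E)%E.
    by near: k; exact: near_aw_dist gl e3.
  have [_ d3] := gP (K + psi k)%N.
  have d4 : (K + psi k).+1%:R^-1 < e / 3.
    apply: (@le_lt_trans _ _ k.+1%:R^-1); first by rewrite lef_pV2 ?posrE// ler_nat.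
    by near: k; exact: near_infty_natSinv_lt (PosNum e3).
  apply: (le_lt_trans (aw_dist_triangle N zctr (a (K + psi k)%N) _ _)).
  apply: (le_lt_trans (leeD2l _ (aw_dist_triangle N zctr (g (K + psi k)%N) _ _))).
  rewrite (aw_dist_sym N zctr _ l).
  apply: (lt_trans (lteD d1 (lteD d3 d2))).
  by rewrite -!EFinD lte_fin; move: (_.+1%:R^-1) d4 => x; lra.
by move=> /filter_ex[_ /ltW]; rewrite EFinD.
Unshelve. all: by end_near. Qed.

End thickening.

(** * Consistency of approximate minimizers *)

Lemma ae_forall_rat d (T : measurableType d) (R : realType)
    (P : {measure set T -> \bar R}) (Q : rat -> T -> Prop) :
  (forall q, {ae P, forall w, Q q w}) -> {ae P, forall w, forall q, Q q w}.
Proof.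
move=> PQ; have : {ae P, forall w, forall n,
    Q (odflt 0%Q (choice.unpickle n)) w} by apply: ae_foralln => n; exact: PQ.
by apply: filterS => w Qw q; have := Qw (choice.pickle q); rewrite choice.pickleK.
Qed.

Theorem theorem3p14 (R : realType)
  (d : nat) (S : set 'rV[R]_d) (S_neq0 : S !=set0) (S_closed : closed S)
  (N : norm_on ('rV[R]_d * R^o)%type) (zctr : 'rV[R]_d * R^o)
  (S_zctr : S zctr.1)
  (d0 : nat) (S0 : set 'rV[R]_d0) (S0_neq0 : S0 !=set0)
  (B0 : set (set (set_ptype S0_neq0))) (B0_sigma : sigma_algebra setT B0)
  (B0_borel : forall V : set 'rV[R]_d0, open V ->
     B0 [set x : set_ptype S0_neq0 | V (val x)])
  (dO : measure_display) (Omega : measurableType dO) (P : probability Omega R)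
  (X : nat -> {mfun Omega >-> g_sigma_algebraType B0})
  (X_iid : iid P X)
  (P0_complete : measure_is_complete (distribution P (X 0%N)))
  (F : set (aw_space N zctr S_neq0)) (F_closed : closed F)
  (Fn : nat -> set (aw_space N zctr S_neq0)) (Fn_sub : forall n, Fn n `<=` F)
  (LimF : set (aw_space N zctr S_neq0)) (LimFP : set_converges Fn LimF)
  (psi : g_sigma_algebraType B0 -> aw_space N zctr S_neq0 -> \bar R)
  (psi_lsc : random_lsc F psi)
  (psi_int : locally_inf_integrable (distribution P (X 0%N)) F psi)
  (pen : nat -> aw_space N zctr S_neq0 -> R)
  (pen_ge0 : forall n f, F f -> 0 <= pen n f)
  (pen_cvg : forall u : nat -> aw_space N zctr S_neq0, (forall n, F (u n)) ->
     cvgn u -> pen n (u n) @[n --> \oo] --> (0 : R))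
  (delta : R) (delta_gt0 : 0 < delta)
  (eps : nat -> R) (eps_ge0 : forall n, 0 <= eps n)
  (eps_cvg : eps n @[n --> \oo] --> (0 : R)) :
  let E := fun f => ext_integral P (fun w => psi (X 0%N w) f) in
  let objective := fun n w f =>
    ((n.+1%:R^-1)%:E * (\sum_(j < n.+1) psi (X j w) f) + (pen n f)%:E)%dE in
  let RHS := [set f | aw_thicken F delta LimF f /\
                      (E f <= ereal_inf [set E g | g in LimF])%E] in
  {ae P, forall w,
    outer_lim (fun n =>
      eps_argmin (eps n) (aw_thicken F delta (Fn n)) (objective n w))
    `<=` RHS} /\
  (LimF = F -> RHS = argmin F E).
Proof.
move=> E objective RHS.
have LimFF : LimF `<=` F := set_limit_sub F_closed Fn_sub LimFP.
have EE f : F f -> E f = (\int[distribution P (X 0%N)]_x psi x f)%E.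
  by move=> Ff; exact: (ext_integral_psi S_closed X_iid P0_complete F_closed psi_lsc psi_int Ff).
split; last first.
  move=> LF; apply/seteqP; split=> f.
    by rewrite /RHS LF => -[[Ff _] Ef]; split=> //; rewrite adde0.
  move=> [Ff]; rewrite adde0 => Ef; rewrite /RHS LF; split=> //; split=> //.
  apply: (@le_trans _ _ 0%E); last by rewrite lee_fin ltW.
  by apply: ereal_inf_lbound; exists f => //; rewrite aw_distxx.
(* One [g] is fixed for each rational level before the null set is chosen. *)
have upper : {ae P, forall w, forall c : rat,
    (exists2 g, LimF g & (E g < (ratr c)%:E)%E) ->
    exists2 g, LimF g & \forall n \near \oo,
      (dual_avg n (fun j => psi (X j w) g) < (ratr c)%:E)%E}.
  apply: ae_forall_rat => c.
  have [[g Lg gc]|ng] := pselect (exists2 g, LimF g & (E g < (ratr c)%:E)%E); last first.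
    by apply: aeW => w /ng.
  have := psi_upper_law S_closed X_iid P0_complete F_closed psi_lsc psi_int
    (LimFF _ Lg) (c := ratr c).
  rewrite -(EE _ (LimFF _ Lg)) => /(_ gc).
  by apply: filterS => w gw _; exists g.
have lower := psi_lower_law S_closed X_iid P0_complete F_closed psi_lsc psi_int.
apply: filterS2 upper lower => w up lo f [phi [a [phi_lt aA af]]].
have aT k : aw_thicken F delta (Fn (phi k)) (a k) by case: (aA k).
have fT : aw_thicken F delta LimF f.
  exact: (thicken_limit S_closed F_closed LimFP phi_lt aT af).
have [Ff _] := fT; split=> //.
(* Two levels [c < c'] are needed: half of the gap absorbs the penalty at [g], the other half the
   tolerance. The penalty at [a k] is merely bounded below by 0. *)
rewrite leNgt; apply/negP => /ereal_rat_between[c /andP[Lc cf]].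
have [c' /andP[cc' c'f]] := ereal_rat_between cf.
rewrite lte_fin in cc'.
have [|g Lg gc] := up c.
  by have [_ [g Lg <-] gc] := ereal_inf_lt Lc; exists g.
rewrite EE// in c'f.
have [r r0 lor] := lo f _ Ff c'f.
have gT := set_limit_thicken F_closed Fn_sub LimFP delta_gt0 Lg.
have e0 : 0 < (ratr c' - ratr c) / 2 :> R by lra.
have pen0 : \forall n \near \oo, pen n g < (ratr c' - ratr c) / 2.
  have cg : cvgn (fun _ : nat => g) by exact: is_cvg_cst.
  have := pen_cvg (fun=> g) (fun=> LimFF _ Lg) cg.
  move=> /cvgrPdist_lt/(_ _ e0); apply: filterS => n; rewrite sub0r normrN.
  exact: le_lt_trans (ler_norm _).
have eps0 : \forall n \near \oo, eps n < (ratr c' - ratr c) / 2.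
  move: eps_cvg => /cvgrPdist_lt/(_ _ e0); apply: filterS => n; rewrite sub0r normrN.
  exact: le_lt_trans (ler_norm _).
have [M _ MP] := filterI (filterI gc lor) (filterI gT (filterI pen0 eps0)).
have [M' _ M'P] := near_aw_dist af r0.
(* A single index gives the contradiction; [k <= phi k] carries the eventual bounds over to the
   subsequence. *)
pose k := maxn M M'.
have Mk : (M <= phi k)%N.
  by apply: leq_trans (leq_maxl M M') _; exact: homo_ltn_geq_id.
have [[gck lok] [gTk [penk epsk]]] := MP _ Mk.
have Fa : F (a k) by case: (aT k).
have := lok _ Fa (ltW (M'P k (leq_maxr M M'))) => lowk.
have [_ opt] := aA k.
have lowobj : ((ratr c')%:E < objective (phi k) w (a k))%E.
  move: lowk (pen_ge0 (phi k) (a k) Fa); rewrite /objective -/(dual_avg (phi k) (fun j => psi (X j w) (a k))).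
  case: (dual_avg _ _) => [x| |] //=; rewrite ?lte_fin => h1 h2.
  by lra.
have uppobj : (objective (phi k) w g <= (ratr c + pen (phi k) g)%:E)%E.
  move: gck; rewrite /objective -/(dual_avg (phi k) (fun j => psi (X j w) g)).
  case: (dual_avg _ _) => [x| |] //=; rewrite ?lte_fin ?leNye// => h1.
  by rewrite lee_fin; lra.
have : ((ratr c')%:E < (ratr c + pen (phi k) g + eps (phi k))%:E)%E.
  apply: (lt_le_trans lowobj); apply: (le_trans opt); rewrite EFinD; apply: leeD => //.
  apply: le_trans uppobj; apply: ereal_inf_lbound.
  by exists g.
by rewrite lte_fin; lra.
Qed.
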